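(* Let $G^*$ be a $p$-vertex DAG with equivalence class $\mathcal E^*=[G^*]$. For each permutation $\sigma\in\mathbb S^p$ let $G^*_\sigma$ be the minimal I-map of $G^*$ with ordering $\sigma$, and let $d^*=\max_{\sigma\in\mathbb S^p}\max_{j\in[p]}|\mathrm{Pa}_j(G^*_\sigma)\cup\mathrm{Ch}_j(G^*_\sigma)|$. Let $d_{\mathrm{in}},d_{\mathrm{out}}\in[p]$ satisfy $d^*\le d_{\mathrm{in}}$ and $\min\{d^*d_{\mathrm{in}}+1,\,p\}\le d_{\mathrm{out}}$. Then $G^*_\sigma\in\mathcal G_p^\sigma(d_{\mathrm{in}},d_{\mathrm{out}})$ for each $\sigma\in\mathbb S^p$. Further, there exists a function $g\colon\mathcal C_p(d_{\mathrm{in}},d_{\mathrm{out}})\to\mathcal C_p(d_{\mathrm{in}},d_{\mathrm{out}})$ such that $g(\mathcal E^* )=\mathcal E^*$ and the following hold for any $\mathcal E\in\mathcal C_p(d_{\mathrm{in}},d_{\mathrm{out}})\setminus\{\mathcal E^*\}$. (i) $g(\mathcal E)=[g_j^\sigma(G)]$ for some $j\in[p]$, $\sigma\in\mathbb S^p$ and $G\in\mathcal E\cap\mathcal G_p^\sigma(d_{\mathrm{in}},d_{\mathrm{out}})$ such that $g_j^\sigma(G)\ne G$, where $g_j^\sigma$ is the nodewise add-delete-swap operator defined in the context. (ii) There exist $k\le(d^*+d_{\mathrm{in}})p$ and $k\le\ell\le(2d^*+d_{\mathrm{in}})p$ such that $g^k(\mathcal E)=[G^*_\sigma]$ for some $\sigma\in\mathbb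 S^p$ and $g^\ell(\mathcal E)=\mathcal E^*$.
   Context: $[p]=\{1,\dots,p\}$; $\mathbb S^p$ is the set of permutations of $[p]$; all DAGs have vertex set $[p]$. $\mathrm{Pa}_j(G)$ and $\mathrm{Ch}_j(G)$ are the sets of parents and children of node $j$ in $G$. Two DAGs are Markov equivalent if they encode the same conditional independence (d-separation) relations; $[G]$ denotes the Markov equivalence class of $G$, viewed as a set of DAGs. $\mathcal G_p(d_{\mathrm{in}},d_{\mathrm{out}})$ is the set of DAGs with $\max_j|\mathrm{Pa}_j(G)|\le d_{\mathrm{in}}$ and $\max_j|\mathrm{Ch}_j(G)|\le d_{\mathrm{out}}$, and $\mathcal C_p(d_{\mathrm{in}},d_{\mathrm{out}})=\{[G]\colon G\in\mathcal G_p(d_{\mathrm{in}},d_{\mathrm{out}})\}$. $\mathcal G_p^\sigma$ is the set of DAGs with topological ordering $\sigma$ (i.e. $\sigma(j)\to\sigma(i)\notin G$ for any $i<j$), and $\mathcal G_p^\sigma(d_{\mathrm{in}},d_{\mathrm{out}})=\mathcal G_p^\sigma\cap\mathcal G_p(d_{\mathrm{in}},d_{\mathrm{out}})$. $g^k$ is the $k$-fold iterate of $g$. Minimal I-map: $G^*_\sigma\in\mathcal G_p^\sigma$ is the DAG such that for $i<j$, $\sigma(i)\to\sigma(j)\in G^*_\sigma$ if and only if nodes $\sigma(i),\sigma(j)$ are not conditionally independent (not d-separated in $G^*$) given $\{\sigma(1),\dots,\sigma(j-1)\}\setminus\{\sigma(i)\}$. Score: $\psi$ is a real-valued function on DAGs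 that is decomposable, $\psi(G)=\sum_{j\in[p]}\psi_j(\mathrm{Pa}_j(G))$ with $\psi_j\colon2^{[p]}\to\mathbb R$, and score equivalent ($\psi(G)=\psi(G')$ for Markov equivalent $G,G'$). Let $\mathcal A_p^\sigma(j)=\{k\in[p]\colon\sigma^{-1}(k)<\sigma^{-1}(j)\}$ and $\mathcal M_p^\sigma(j,d_{\mathrm{in}})=\{S\subseteq\mathcal A_p^\sigma(j)\colon|S|\le d_{\mathrm{in}}\}$. Operators: let $S^*_{\sigma,j}=\mathrm{Pa}_j(G^*_\sigma)$. For $S\in\mathcal M_p^\sigma(j,d_{\mathrm{in}})$, put $T=S^*_{\sigma,j}\setminus S$, $R=S\setminus S^*_{\sigma,j}$, and define (i) if $S=S^*_{\sigma,j}$, $g_j^\sigma(S)=S^*_{\sigma,j}$; (ii) if $S^*_{\sigma,j}\subsetneq S$, $g_j^\sigma(S)=S\setminus\{\tilde\ell\}$ with $\tilde\ell=\arg\max_{\ell\in R}\psi_j(S\setminus\{\ell\})$; (iii) if $S^*_{\sigma,j}\not\subseteq S$ and $|S|<d_{\mathrm{in}}$, $g_j^\sigma(S)=S\cup\{\tilde k\}$ with $\tilde k=\arg\max_{k\in T}\psi_j(S\cup\{k\})$; (iv) if $S^*_{\sigma,j}\not\subseteq S$ and $|S|=d_{\mathrm{in}}$, $g_j^\sigma(S)=(S\cup\{\tilde k\})\setminus\{\tilde\ell\}$ with $(\tilde k,\tilde\ell)=\arg\max_{(k,\ell)\in T\times R}\psi_j((S\cup\{k\})\setminus\{\ell\})$.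 (Ties broken by any fixed rule.) For a DAG $G$ with $\mathrm{Pa}_j(G)\in\mathcal M_p^\sigma(j,d_{\mathrm{in}})$, $g_j^\sigma(G)$ is the DAG with $\mathrm{Pa}_j(g_j^\sigma(G))=g_j^\sigma(\mathrm{Pa}_j(G))$ and $\mathrm{Pa}_i(g_j^\sigma(G))=\mathrm{Pa}_i(G)$ for $i\ne j$. *)

(* Defs.v *)
From mathcomp Require Import all_boot all_order all_fingroup all_algebra.
From mathcomp Require Import boolp reals.

Set Implicit Arguments.
Unset Strict Implicit.
Unset Printing Implicit Defensive.

Import Order.TTheory GRing.Theory Num.Theory.

(* Nodes are 'I_p (0-based); a directed graph is its set of edges, (i, j)      *)
(* standing for i -> j.                                                        *)
Notation digraph p := {set 'I_p * 'I_p}.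

Section Graphs.
Variable p : nat.
Implicit Types (G H : digraph p) (s : 'S_p) (A B C S : {set 'I_p}).

Definition edge G : rel 'I_p := fun i j => (i, j) \in G.

Definition Pa G (j : 'I_p) : {set 'I_p} := [set i | (i, j) \in G].
Definition Ch G (j : 'I_p) : {set 'I_p} := [set i | (j, i) \in G].

(* No edge closes a directed walk; this excludes self-loops too.               *)
Definition is_dag G : bool :=
  [forall i, forall j, edge G i j ==> ~~ connect (edge G) j i].

Definition adjacent G : rel 'I_p := fun i j => edge G i j || edge G j i.

Definition collider G (x y z : 'I_p) : bool := edge G x y && edge G z y.

(* Every inner node y of the path is open given C: a collider must have a      *)
(* descendant (possibly itself) in C, a non-collider must lie outside C.       *)
Fixpoint unblocked G C (q : seq 'I_p) : bool :=
  match q with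
  | x :: q' =>
      match q' with
      | y :: z :: _ =>
          (if collider G x y z then [exists d in C, connect (edge G) y d]
           else y \notin C) && unblocked G C q'
      | _ => true
      end
  | [::] => true
  end.

Definition d_connected G C (a b : 'I_p) : Prop :=
  exists q : seq 'I_p,
    [/\ uniq (a :: q), path (adjacent G) a q, last a q = b
      & unblocked G C (a :: q)].

Definition d_separated G A B C : Prop :=
  forall a b, a \in A -> b \in B -> ~ d_connected G C a b.

Definition markov_equiv G H : Prop :=
  forall A B C, [disjoint A & B] -> [disjoint A & C] -> [disjoint B & C] ->
    (d_separated G A B C <-> d_separated H A B C).

Definition eq_class G : {set digraph p} :=
  [set H | is_dag H && `[< markov_equiv G H >]].

Definition Gp (din dout : nat) : {set digraph p} :=
  [set G | [&& is_dag G, [forall j, #|Pa G j| <= din]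
             & [forall j, #|Ch G j| <= dout]]].

Definition Cp (din dout : nat) : {set {set digraph p}} :=
  [set eq_class G | G in Gp din dout].

(* s i is the i-th node of the ordering.                                       *)
Definition topological s G : bool :=
  [forall i : 'I_p, forall j : 'I_p, (i < j) ==> ((s j, s i) \notin G)].

Definition Gps s : {set digraph p} := [set G | is_dag G && topological s G].

Definition Gpsd s (din dout : nat) : {set digraph p} := Gps s :&: Gp din dout.

Definition preds s (j : 'I_p) : {set 'I_p} :=
  [set k | (s^-1)%g k < (s^-1)%g j].

Definition Mps s (j : 'I_p) (din : nat) : {set {set 'I_p}} :=
  [set S : {set 'I_p} | (S \subset preds s j) && (#|S| <= din)].

(* The edge u -> v, with u before v in the ordering s, is present iff u and v  *)
(* are not d-separated in G given the other predecessors of v.                 *)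
Definition min_imap G s : digraph p :=
  [set e | (e.1 \in preds s e.2) &&
     ~~ `[< d_separated G [set e.1] [set e.2] (preds s e.2 :\ e.1) >]].

Definition dstar G : nat :=
  \max_(s : 'S_p) \max_(j < p) #|Pa (min_imap G s) j :|: Ch (min_imap G s) j|.

Definition set_parents G (j : 'I_p) S : digraph p :=
  [set e | if e.2 == j then e.1 \in S else e \in G].

Lemma Pa_set_parents G j S i :
  Pa (set_parents G j S) i = if i == j then S else Pa G i.
Proof. by apply/setP=> k; rewrite !inE /=; case: eqP; rewrite ?inE. Qed.

End Graphs.

Section Scores.
Variables (R : realType) (p : nat).
Implicit Types (psi : digraph p -> R) (psiloc : 'I_p -> {set 'I_p} -> R).

Definition decomposable psi psiloc : Prop :=
  forall G, is_dag G -> psi G = (\sum_(j < p) psiloc j (Pa G j))%R.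

Definition score_equivalent psi : Prop :=
  forall G H, is_dag G -> is_dag H -> markov_equiv G H -> psi G = psi H.

Definition is_argmax (T : finType) (A : {set T}) (f : T -> R) (x : T) : Prop :=
  x \in A /\ forall y, y \in A -> (f y <= f x)%R.

(* S' is an admissible value of the add-delete-swap operator at S, where Sstar *)
(* is the target parent set and f the local score; several S' qualify exactly  *)
(* when the maximizer is not unique.                                           *)
Definition ads_step (f : {set 'I_p} -> R) (din : nat)
    (Sstar S S' : {set 'I_p}) : Prop :=
  let T := Sstar :\: S in
  let D := S :\: Sstar in
  [/\ S = Sstar -> S' = Sstar,
      Sstar \proper S ->
        exists2 l, is_argmax D (fun l => f (S :\ l)) l & S' = S :\ l,
      ~~ (Sstar \subset S) -> #|S| < din ->
        exists2 k, is_argmax T (fun k => f (k |: S)) k & S' = k |: S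
    & ~~ (Sstar \subset S) -> #|S| = din ->
        exists2 kl : 'I_p * 'I_p,
          is_argmax (setX T D) (fun kl => f ((kl.1 |: S) :\ kl.2)) kl
          & S' = (kl.1 |: S) :\ kl.2].

(* g s j is the operator at node j for the ordering s. A function g with this  *)
(* property is the same thing as a tie-breaking rule, which may depend on s, j *)
(* and S; values outside Mps s j din are irrelevant.                           *)
Definition ads_operator psiloc (G : digraph p) (din : nat)
    (g : 'S_p -> 'I_p -> {set 'I_p} -> {set 'I_p}) : Prop :=
  forall s j S, S \in Mps s j din ->
    ads_step (psiloc j) din (Pa (min_imap G s) j) S (g s j S).

Definition apply_node (g : 'S_p -> 'I_p -> {set 'I_p} -> {set 'I_p})
    (s : 'S_p) (j : 'I_p) (G : digraph p) : digraph p :=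
  set_parents G j (g s j (Pa G j)).

Lemma argmax_exists (T : finType) (A : {set T}) (f : T -> R) :
  A != set0 -> exists x, is_argmax A f x.
Proof.
case/set0Pn=> x0 Ax0.
by case: (arg_maxP f Ax0) => x Ax maxx; exists x; split=> // y /maxx.
Qed.

(* An operator always exists once the target parent sets have size <= din.     *)
Lemma ads_operator_exists psiloc (G : digraph p) (din : nat) :
  dstar G <= din -> exists g, ads_operator psiloc G din g.
Proof.
move=> le_d.
suff step s j S : exists S', S \in Mps s j din ->
    ads_step (psiloc j) din (Pa (min_imap G s) j) S S'.
  have /choice [h hP] (x : 'S_p * 'I_p * {set 'I_p}) := step x.1.1 x.1.2 x.2.
  by exists (fun s j S => h (s, j, S)) => s j S; apply: (hP (s, j, S)).
set Q := Pa _ _; have leQ : #|Q| <= din.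
  apply: leq_trans le_d; rewrite /dstar.
  apply: leq_trans (leq_bigmax s); apply: leq_trans (leq_bigmax j).
  exact/subset_leq_card/subsetUl.
have [SM|] := boolP (S \in Mps s j din); last by exists S.
have leS : #|S| <= din by move: SM; rewrite inE => /andP[].
have [eqSQ|neQ] := eqVneq S Q.
  by exists Q => _; split=> //; rewrite eqSQ ?properxx ?subxx.
have [sQS|nsQS] := boolP (Q \subset S).
  have pQS : Q \proper S by rewrite properEneq eq_sym neQ.
  have D0 : S :\: Q != set0 by rewrite setD_eq0 proper_subn.
  have [l lP] := argmax_exists (fun l => psiloc j (S :\ l)) D0.
  by exists (S :\ l) => _; split; rewrite ?sQS //; [move/eqP: neQ | move=> _; exists l].
have npQS : ~~ (Q \proper S) by apply: contra nsQS => /proper_sub.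
have T0 : Q :\: S != set0 by rewrite setD_eq0.
have [ltS|geS] := ltnP #|S| din.
  have [k kP] := argmax_exists (fun k => psiloc j (k |: S)) T0.
  exists (k |: S) => _; split; rewrite ?(negPf npQS) //; first by move/eqP: neQ.
    by move=> _ _; exists k.
  by move=> _ eqS; rewrite eqS ltnn in ltS.
have D0 : S :\: Q != set0.
  rewrite setD_eq0; apply: contra neQ => sSQ.
  by rewrite eqEcard sSQ (leq_trans leQ).
have TD0 : setX (Q :\: S) (S :\: Q) != set0.
  case/set0Pn: T0 => k kT; case/set0Pn: D0 => l lD.
  by apply/set0Pn; exists (k, l); rewrite in_setX kT.
have [kl klP] :=
  argmax_exists (fun kl => psiloc j ((kl.1 |: S) :\ kl.2)) TD0.
exists ((kl.1 |: S) :\ kl.2) => _; split.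
- by move/eqP: neQ.
- by rewrite (negPf npQS).
- by move=> _; rewrite ltnNge geS.
- by move=> _ _; exists kl.
Qed.

End Scores.

(* Main.v *)
Require Import Defs.
From mathcomp Require Import all_boot all_order all_fingroup all_algebra.
From mathcomp Require Import boolp reals.
From mathcomp Require Import zify.

(* Write Q s for the minimal I-map of Gstar with ordering s.

   Call a class reachable in n steps if n moves of the operators lead from it
   to the class of Gstar.  From G with ordering s, some operator always applies
   without breaking the bound on the number of children (double counting), and
   it shrinks the symmetric difference of G and Q s.  From the class of Q s,
   one goes down as in Chickering's proof of Meek's conjecture: Gstar is
   transformed into Q s by edge additions and covered edge reversals, all
   intermediate graphs being I-maps of Gstar.  If there is no addition, Q s is
   Markov equivalent to Gstar; otherwise the graph H1 after the last addition
   is equivalent to Q s but properly contains Q t for every ordering t of H1,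
   and the operators for t lead from H1 to Q t.  Thus G reaches Gstar in at
   most |G| + 2 |Q s| steps, and 2 |Q s| <= dstar * p by counting degrees, so
   both k and l can be taken to be (dstar + din) * p, and g moves along a
   shortest path towards the class of Gstar.

   To transform a graph into Q s, its nodes are made compatible with s one by
   one, the last first: the last incompatible y is pulled behind its child z
   that leads to the s-first descendant of y, after adding the edges that make
   y -> z covered.  Since y comes late in s and z is an ancestor of every set
   {x | x <= v in s} that contains a descendant of y, the new moral edges can be
   rerouted through y, so that no new edge appears in the minimal I-map. *)

Set Implicit Arguments.
Unset Strict Implicit.
Unset Printing Implicit Defensive.

(** * d-separation and moral graphs *)

Section Separation.
Variable p : nat.
Implicit Types (G H K : digraph p) (A C : {set 'I_p}) (a b x y z : 'I_p).

Definition anc G C : {set 'I_p} := [set x | [exists d in C, connect (edge G) x d]].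

Definition moral G A : rel 'I_p := fun x y =>
  [|| edge G x y, edge G y x | [exists w in A, edge G x w && edge G y w]].

Definition mrel G A C : rel 'I_p := fun x y =>
  [&& x \in A :\: C, y \in A :\: C & moral G A x y].

(** The moral graph criterion for d-connection: a path in the moral graph of the ancestral set of a,
    b and C that avoids C. Unlike [d_connected], it can be transferred between graphs edge by
    edge. *)
Definition mconn G C a b : bool :=
  connect (mrel G (anc G (a |: (b |: C))) C) a b.

Lemma moral_sym G A x y : moral G A x y = moral G A y x.
Proof.
by rewrite /moral orbCA; do 2!congr orb; apply: eq_existsb => w; rewrite [edge G x w && _]andbC.
Qed.

Lemma mrel_sym G A C : connect_sym (mrel G A C).
Proof. by apply: sym_connect_sym => x y; rewrite /mrel moral_sym andbCA. Qed.

Lemma dag_asym G x y : is_dag G -> edge G x y -> edge G y x = false.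
Proof.
move=> /forallP/(_ x)/forallP/(_ y)/implyP dG /dG; apply: contraNF; exact: connect1.
Qed.

Lemma dag_irr G x : is_dag G -> edge G x x = false.
Proof. by move=> dG; apply/negP=> e; have := e; rewrite (dag_asym dG e). Qed.

Lemma sub_anc G C : C \subset anc G C.
Proof. by apply/subsetP=> x xC; rewrite inE; apply/existsP; exists x; rewrite xC /=. Qed.

Lemma anc_closed G C x y : edge G x y -> y \in anc G C -> x \in anc G C.
Proof.
move=> e; rewrite !inE => /existsP[d /andP[dC c]]; apply/existsP; exists d.
by rewrite dC (connect_trans (connect1 e)).
Qed.

Lemma anc_connect G C x y : connect (edge G) x y -> y \in anc G C -> x \in anc G C.
Proof.
move=> e; rewrite !inE => /existsP[d /andP[dC c]]; apply/existsP; exists d.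
by rewrite dC (connect_trans e).
Qed.

Lemma anc_sub G C A : C \subset A ->
  (forall x y, edge G x y -> y \in A -> x \in A) -> anc G C \subset A.
Proof.
move=> sCA clA; apply/subsetP=> x; rewrite inE => /existsP[d /andP[/(subsetP sCA) dA]].
case/connectP=> q; elim: q x => [|y q IH] x /= => [_ <- //|/andP[e pq] ld].
exact: clA e (IH _ pq ld).
Qed.

(** * Open walks versus paths in the moral graph *)

Section Walks.
Variables (G : digraph p) (C : {set 'I_p}).
Hypothesis dG : is_dag G.

Lemma unblocked_cons x y z q :
  unblocked G C [:: x, y, z & q] =
  (if collider G x y z then y \in anc G C else y \notin C)
     && unblocked G C [:: y, z & q].
Proof. by rewrite /= inE. Qed.

Lemma unblocked_behead x q : unblocked G C (x :: q) -> unblocked G C q.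
Proof. by case: q => [|y [|z q]] //; rewrite unblocked_cons => /andP[]. Qed.

Lemma unblocked_cat l x y q :
  unblocked G C (l ++ [:: x, y & q]) =
  unblocked G C (l ++ [:: x; y]) && unblocked G C [:: x, y & q].
Proof.
elim: l => [|u l IH] //; case: l IH => [|v [|w l]] IH.
- by rewrite !cat1s !unblocked_cons andbT.
- by move: IH; rewrite !cat_cons !cat0s !(unblocked_cons u) => ->; rewrite andbA.
- by move: IH; rewrite !cat_cons !(unblocked_cons u) => ->; rewrite andbA.
Qed.

Lemma unblocked_suffix l q : unblocked G C (l ++ q) -> unblocked G C q.
Proof. by elim: l => // x l IH; rewrite cat_cons => /unblocked_behead. Qed.

Lemma unblocked_prefix l x y q :
  unblocked G C (l ++ [:: x, y & q]) -> unblocked G C (l ++ [:: x; y]).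
Proof. by rewrite unblocked_cat => /andP[]. Qed.

(** From an outgoing edge the walk either runs forward to its end, which lies in A, or meets a
    collider, which is an ancestor of C. In both cases y is an ancestor of A. *)
Lemma out_in_anc A x y q : C \subset A ->
  (forall x y, edge G x y -> y \in A -> x \in A) ->
  path (adjacent G) x (y :: q) -> unblocked G C [:: x, y & q] -> edge G x y ->
  last y q \in A -> y \in A.
Proof.
move=> sCA clA; elim: q x y => [|z q IH] x y //.
rewrite unblocked_cons => /andP[_ pq] /andP[ok ub] exy lA.
case: (boolP (edge G z y)) ok => [ezy|nezy].
  rewrite /collider exy ezy => /(subsetP (anc_sub sCA clA)); exact.
move=> _; have eyz : edge G y z.
  by move: pq => /andP[/orP[//|]]; rewrite (negPf nezy).
by apply: (clA _ _ eyz); apply: (IH y z).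
Qed.

Lemma walk_in_anc A x q : C \subset A ->
  (forall x y, edge G x y -> y \in A -> x \in A) ->
  path (adjacent G) x q -> unblocked G C (x :: q) -> x \in A ->
  last x q \in A -> all (mem A) (x :: q).
Proof.
move=> sCA clA; elim: q x => [|y q IH] x pq ub xA lA; first by rewrite /= xA.
rewrite [all _ _]/= xA /=; move: (pq) => /= /andP[adj pq'].
apply: IH => //; first exact: unblocked_behead ub.
case/orP: adj => e; last exact: clA e xA.
exact: out_in_anc pq ub e lA.
Qed.

(** A collider is skipped by the moral edge between its two neighbours. The neighbour after it has
    an outgoing edge there, so it is no collider and lies outside C. *)
Lemma walk_connect A x q : path (adjacent G) x q -> unblocked G C (x :: q) ->
  all (mem A) (x :: q) -> x \notin C -> last x q \notin C ->
  connect (mrel G A C) x (last x q).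
Proof.
have [n] := ubnP (size q); elim: n x q => // n IH x [|y [|z q]] //= sz.
- rewrite andbT => adj _ /and3P[xA yA _] xC yC; apply: connect1.
  by rewrite /mrel !inE xA yA xC yC /moral; case/orP: adj => ->; rewrite ?orbT.
move=> /and3P[axy ayz pq]; rewrite -/(unblocked G C [:: x, y, z & q]) unblocked_cons.
move=> /andP[ok ub] /and4P[xA yA zA qA] xC lC.
case: ifP ok => [/andP[exy ezy] _|ncol yC].
  have zC : z \notin C.
    case: q lC ub pq {sz qA} => [|w q] //= _; rewrite -/(unblocked G C [:: y, z, w & q]).
    by rewrite unblocked_cons /collider (dag_asym dG ezy) => /andP[].
  apply: (@connect_trans _ _ z); last first.
    by apply: IH => //=; rewrite ?zA ?qA //; [lia | exact: unblocked_behead ub].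
  apply: connect1; rewrite /mrel !inE xA xC zA zC /moral.
  by apply/or3P/Or33/existsP; exists y; rewrite [y \in A]yA exy ezy.
apply: (@connect_trans _ _ y); last first.
  by apply: (IH y (z :: q)) => //=; rewrite ?ayz ?pq ?yA ?zA ?qA //; lia.
apply: connect1; rewrite /mrel !inE xA xC yA yC /moral.
by case/orP: axy => ->; rewrite ?orbT.
Qed.

Lemma d_connected_mconn a b : a \notin C -> b \notin C ->
  d_connected G C a b -> mconn G C a b.
Proof.
move=> aC bC [q [_ pq lq ub]]; rewrite /mconn; set A := anc _ _.
have sA : a |: (b |: C) \subset A by apply: sub_anc.
move: sA; rewrite !subUset !sub1set => /and3P[aA bA sCA].
rewrite -lq in bC bA *; apply: walk_connect => //.
by apply: walk_in_anc => // x y; apply: anc_closed.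
Qed.

(** Nodes may repeat, so that walks can be extended freely; [dwalk_d_connected] restores
    uniqueness. *)
Definition dwalk x b := exists q,
  [/\ path (adjacent G) x q, last x q = b & unblocked G C (x :: q)].

Lemma dwalk_in b x y : dwalk x b -> edge G x y -> x \notin C -> dwalk y b.
Proof.
case=> q [pq lq ub] e xC; exists (x :: q); split=> //.
  by rewrite /= /adjacent e orbT.
case: q ub {pq lq} => [|z q] // ub; rewrite unblocked_cons ub andbT /collider.
by rewrite (dag_asym dG e).
Qed.

Lemma dwalk_out b x y : dwalk x b -> edge G y x -> x \in anc G C -> x \notin C ->
  dwalk y b.
Proof.
case=> q [pq lq ub] e xX xC; exists (x :: q); split=> //.
  by rewrite /= /adjacent e.
case: q ub {pq lq} => [|z q] // ub; rewrite unblocked_cons ub andbT.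
by case: ifP.
Qed.

Lemma notin_anc x : x \notin anc G C -> x \notin C.
Proof. by apply: contra; apply/subsetP/sub_anc. Qed.

Lemma directed_unblocked x y q : path (edge G) x (y :: q) -> y \notin anc G C ->
  path (adjacent G) x (y :: q) /\ unblocked G C [:: x, y & q].
Proof.
elim: q x y => [|z q IH] x y.
  by move=> /= /andP[exy _]; rewrite /adjacent exy.
move=> /= /and3P[exy eyz pq] yX.
have zX : z \notin anc G C by apply: contra yX; apply: anc_closed.
have [|pz uz] := IH y z _ zX; first by rewrite /= eyz.
split; first by rewrite /adjacent exy; move: pz.
rewrite -/(unblocked G C [:: x, y, z & q]) unblocked_cons /collider (dag_asym dG eyz) andbF.
by rewrite uz notin_anc.
Qed.

Lemma dwalk_directed b x y : edge G y x -> connect (edge G) x b ->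
  x \notin anc G C -> dwalk y b.
Proof.
move=> e /connectP[q pq ->] xX; exists (x :: q).
by have [|p1 u1] := @directed_unblocked y x q _ xX; rewrite /= ?e.
Qed.

Lemma dwalk_back b x a : dwalk x b -> connect (edge G) x a -> x \notin anc G C ->
  dwalk a b.
Proof.
move=> W /connectP[q]; elim: q x W => [|y q IH] x W /=; first by move=> _ ->.
move=> /andP[e pq] la xX.
apply: IH la _ => //; first by apply: dwalk_in W e (notin_anc xX).
by apply: contra xX; apply: anc_closed.
Qed.

Lemma anc_case a b x : x \in anc G (a |: (b |: C)) -> x \notin anc G C ->
  connect (edge G) x a \/ connect (edge G) x b.
Proof.
rewrite !inE => /existsP[d /andP[]]; rewrite !inE => /or3P[/eqP->|/eqP->|dC] c; [by left|by right|].
by case/negP; apply/existsP; exists d; rewrite dC.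
Qed.

(** The moral edge is prepended to the walk. This fails only if it would enter a node that is not an
    ancestor of C; that node is an ancestor of a or b. A directed path to b replaces the rest of the
    walk, and one to a, reversed, makes the walk start at a, whence the second alternative. *)
Lemma dwalk_mrel a b x y : mrel G (anc G (a |: (b |: C))) C y x ->
  dwalk x b -> dwalk y b \/ dwalk a b.
Proof.
set A := anc _ _ => /and3P[/setDP[yA yC] /setDP[xA xC] m] W.
have up w : dwalk w b -> edge G y w -> w \in A -> w \notin anc G C ->
    dwalk y b \/ dwalk a b.
  move=> Ww e wA wX; case: (anc_case wA wX) => c; last by left; apply: dwalk_directed e c wX.
  by right; apply: dwalk_back Ww c wX.
case/or3P: m => [e|e|/existsP[w /and3P[wA eyw exw]]].
- have [xX|xX] := boolP (x \in anc G C); first by left; apply: dwalk_out W e xX xC.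
  exact: up xX.
- by left; apply: dwalk_in W e xC.
have [wX|wX] := boolP (w \in anc G C); last by apply: (up w) => //; apply: dwalk_in W exw xC.
left; case: W => q [pq lq ub]; exists [:: w, x & q]; split=> //.
  by rewrite /= /adjacent eyw exw orbT.
rewrite unblocked_cons /collider eyw exw wX.
case: q ub {pq lq} => [|z q] // ub; rewrite unblocked_cons ub andbT /collider.
by rewrite (dag_asym dG exw) xC.
Qed.

Lemma mconn_dwalk a b : mconn G C a b -> dwalk a b.
Proof.
case/connectP=> q pq lq; suff H y : path (mrel G (anc G (a |: (b |: C))) C) y q ->
    b = last y q -> dwalk y b \/ dwalk a b by case: (H a pq lq).
elim: q y {pq lq} => [|x q IH] y /=; first by move=> _ ->; left; exists [::].
move=> /andP[m pq] lq; case: (IH x pq lq) => W; last by right.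
exact: dwalk_mrel m W.
Qed.

(** The walk is directed up to its first collider, which is an ancestor of C, and so is x then. *)
Lemma directed_or_anc x y q : path (adjacent G) x (y :: q) ->
  unblocked G C [:: x, y & q] -> edge G x y ->
  x \in anc G C \/ path (edge G) x (y :: q).
Proof.
elim: q x y => [|z q IH] x y; first by move=> _ _ /= ->; right.
rewrite unblocked_cons => /andP[_ pq] /andP[ok ub] exy.
case: (boolP (edge G z y)) ok => [ezy|nezy].
  by rewrite /collider exy ezy => /(anc_closed exy); left.
have eyz : edge G y z.
  by move: pq => /andP[/orP[//|]]; rewrite (negPf nezy).
move=> _; case: (IH y z pq ub eyz) => [/(anc_closed exy)|pe]; first by left.
by right; rewrite /= exy; exact: pe.
Qed.

(* Removing a loop at w keeps a walk open: if w becomes a collider although it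
   was a non-collider at both ends of the loop, then the loop leaves w twice
   along outgoing edges, so it contains a collider that descends from w. *)
Lemma unblocked_loop x w l z l3 :
  path (adjacent G) x (w :: l ++ [:: w, z & l3]) ->
  unblocked G C (x :: w :: l ++ [:: w, z & l3]) ->
  unblocked G C [:: x, w, z & l3].
Proof.
move=> pt ub; rewrite /= cat_path /= in pt; case/and5P: pt => axw pl adjl adjz pl3.
have ubw : unblocked G C [:: w, z & l3].
  exact: (@unblocked_suffix [:: x, w & l]).
rewrite unblocked_cons ubw andbT.
have ub' := unblocked_behead ub.
case: l pl adjl ub ub' => [_|u l]; first by rewrite /= /adjacent dag_irr.
move=> /andP[awu pl] adjl ub ub'.
have okl : if collider G x w u then w \in anc G C else w \notin C.
  by have := ub; rewrite -/(unblocked G C [:: x, w, u & l ++ [:: w, z & l3]]) unblocked_cons => /andP[].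
have okr : if collider G (last u l) w z then w \in anc G C else w \notin C.
  have ubs : unblocked G C [:: last u l, w, z & l3].
    apply: (@unblocked_suffix (w :: belast u l)).
    by rewrite cat_cons -cat_rcons -lastI.
  by move: ubs; rewrite unblocked_cons => /andP[].
case: ifP => [/andP[exw ezw]|].
  case: (boolP (edge G u w)) okl => [euw|neuw]; first by rewrite /collider exw euw.
  move=> _; have ewu : edge G w u by case/orP: awu => //; rewrite (negPf neuw).
  have [] := @directed_or_anc w u (l ++ [:: w, z & l3]) _ ub' ewu => //.
    by rewrite /= awu cat_path /= adjl adjz pl3 !andbT.
  rewrite -cat_cons cat_path /= => /and3P[_ _ /andP[ewz _]].
  by rewrite (dag_asym dG ewz) in ezw.
move=> /negbT; rewrite negb_and => /orP[n|n].
  by move: okl; rewrite /collider (negPf n).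
by move: okr; rewrite /collider (negPf n) andbF.
Qed.

(** Induction on length: the loop between two occurrences of a node w is cut out. If w is the
    starting node, a suffix of the walk suffices; otherwise [unblocked_loop] keeps w open. *)
Lemma dwalk_d_connected a b : dwalk a b -> d_connected G C a b.
Proof.
case=> q; have [n] := ubnP (size q); elim: n a q => // n IH a q sz [pq lq ub].
have [u|/negP nu] := boolP (uniq (a :: q)); first by exists q.
have [l1 [w [l2 [l3 eq]]]] : exists l1 w l2 l3, a :: q = l1 ++ w :: l2 ++ w :: l3.
  elim: (a :: q) nu => [|x s IHs] //=; case: (boolP (x \in s)) => [xs _|xs /= /IHs].
    by case/splitPr: xs => s1 s2; exists [::], x, s1, s2.
  by case=> l1 [w [l2 [l3 ->]]]; exists (x :: l1), w, l2, l3.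
case: l1 eq => [|a' l1] [eqa eq].
  subst a q; have [] := IH w l3; last by move=> q' hq'; exists q'.
    by move: sz; rewrite size_cat /=; lia.
  have ub3 := @unblocked_suffix (w :: l2) _ ub.
  by move: pq lq; rewrite cat_path last_cat /= => /and3P[_ _ ->] ->.
subst a' q; apply: (IH a (l1 ++ w :: l3)).
  by move: sz; rewrite !size_cat /= size_cat /=; lia.
rewrite cat_path /= cat_path /= in pq; rewrite last_cat /= last_cat /= in lq.
case/and5P: pq => [p1 a1 p2 a2 p3].
have pq : path (adjacent G) a (l1 ++ w :: l3) by rewrite cat_path /= p1 a1.
have lq' : last a (l1 ++ w :: l3) = b by rewrite last_cat.
split=> // {pq lq'}.
have eql r : a :: l1 ++ r = belast a l1 ++ last a l1 :: r by rewrite -cat_cons lastI cat_rcons.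
have ub1 : unblocked G C (belast a l1 ++ [:: last a l1; w]).
  move: ub; rewrite eql; case: (l2 ++ w :: l3) => [|u r] ub; first exact: ub.
  exact: unblocked_prefix ub.
rewrite eql; case: l3 a2 p3 lq ub {sz nu} => [|z l3] // a2 p3 _ ub.
rewrite unblocked_cat ub1; apply: (@unblocked_loop _ _ l2).
  by rewrite /= a1 cat_path p2 /= a2; move: p3.
by apply: (@unblocked_suffix (belast a l1)); rewrite -eql.
Qed.

Lemma d_connectedP a b : a \notin C -> b \notin C ->
  d_connected G C a b <-> mconn G C a b.
Proof.
by move=> aC bC; split=> [|/mconn_dwalk/dwalk_d_connected //]; apply: d_connected_mconn.
Qed.

End Walks.
End Separation.

(** * I-maps and orderings *)

Section Imap.
Variable p : nat.
Implicit Types (G H K : digraph p) (A B C : {set 'I_p}) (a b x y z : 'I_p) (s : 'S_p).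

(** K is an I-map of G, in contrapositive form. Single nodes a and b are enough, as [d_separated] is
    pointwise in its first two sets. *)
Definition imap G K : Prop := forall C a b, a \notin C -> b \notin C ->
  mconn G C a b -> mconn K C a b.

Lemma imap_refl G : imap G G.
Proof. by []. Qed.

Lemma imap_trans G H K : imap G H -> imap H K -> imap G K.
Proof. by move=> GH HK C a b aC bC /(GH _ _ _ aC bC)/(HK _ _ _ aC bC). Qed.

Lemma imap_markov_equiv G K : is_dag G -> is_dag K ->
  imap G K -> imap K G -> markov_equiv G K.
Proof.
move=> dG dK GK KG A B C _ dAC dBC.
have nA a : a \in A -> a \notin C by move=> aA; rewrite (disjointFr dAC aA).
have nB b : b \in B -> b \notin C by move=> bB; rewrite (disjointFr dBC bB).
split=> sep a b aA bB /d_connectedP con; apply: (sep a b aA bB);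
  have {}con := con ltac:(done) (nA a aA) (nB b bB); apply/d_connectedP=> //; auto.
Qed.

Lemma mrel_sub G A K B C : A \subset B -> G \subset K ->
  subrel (mrel G A C) (mrel K B C).
Proof.
move=> /subsetP sAB /subsetP sGK x y /and3P[/setDP[xA xC] /setDP[yA yC] m].
rewrite /mrel !inE xC yC !sAB //=; case/or3P: m => [e|e|/existsP[w /and3P[wA e1 e2]]].
- by apply/or3P/Or31/sGK.
- by apply/or3P/Or32/sGK.
by apply/or3P/Or33/existsP; exists w; rewrite sAB //= /edge !sGK.
Qed.

Lemma sub_imap G K : G \subset K -> imap G K.
Proof.
move=> sGK C a b _ _; apply: connect_sub => x y /(mrel_sub _ sGK) m.
apply/connect1/m/anc_sub; first exact: sub_anc.
by move=> u v e; apply: anc_closed; apply: (subsetP sGK).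
Qed.

Lemma min_imapE G s u v : is_dag G -> ((u, v) \in min_imap G s) =
  (u \in preds s v) && mconn G (preds s v :\ u) u v.
Proof.
move=> dG; rewrite inE /=; congr andb.
have uC : u \notin preds s v :\ u by rewrite !inE eqxx.
have vC : v \notin preds s v :\ u by rewrite !inE ltnn andbF.
apply/idP/idP => [/asboolPn nsep|con].
  apply/negP => /negP ncon; apply: nsep => a b /set1P-> /set1P-> /d_connectedP con.
  by move/negP: ncon; apply; apply: con.
apply/asboolPn => sep; apply: (sep u v); rewrite ?set11 //.
exact/d_connectedP.
Qed.

Lemma topological_rank G (f : 'I_p -> nat) :
  (forall x y, edge G x y -> f x < f y) -> is_dag G.
Proof.
move=> fP; apply/forallP=> x; apply/forallP=> y; apply/implyP=> e.
apply/negP=> /connectP[q pq lq]; have := fP _ _ e; rewrite ltnNge => /negP; apply.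
rewrite {e x}lq; elim: q y pq => [|z q IH] y //= /andP[/fP/ltnW e /IH].
exact: leq_trans.
Qed.

Lemma topologicalP s G :
  reflect (forall x y, edge G x y -> (s^-1)%g x < (s^-1)%g y) (is_dag G && topological s G).
Proof.
apply: (iffP andP) => [[dG /forallP tG] x y e|fP].
  have [//|le] := ltnP; have := forallP (tG ((s^-1)%g y)) ((s^-1)%g x).
  rewrite !permKV; move: le; rewrite leq_eqVlt => /orP[/eqP eq|lt].
    by have := e; rewrite (perm_inj (val_inj eq)) dag_irr.
  by rewrite lt /=; move: e; rewrite /edge => ->.
split; first exact: topological_rank fP.
apply/forallP=> i; apply/forallP=> j; apply/implyP=> lt; apply/negP=> /fP.
by rewrite !permK ltnNge ltnW.
Qed.

Lemma in_Gps s G :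
  reflect (forall x y, edge G x y -> (s^-1)%g x < (s^-1)%g y) (G \in Gps s).
Proof. rewrite inE; exact: topologicalP. Qed.

Lemma Gps_dag s G : G \in Gps s -> is_dag G.
Proof. by rewrite inE => /andP[]. Qed.

Lemma dag_rank G : is_dag G ->
  exists f : 'I_p -> nat, forall x y, edge G x y -> f x < f y.
Proof.
move=> dG; exists (fun x => #|[set y | connect (edge G) y x]|) => x y e.
apply: proper_card; apply/properP; split.
  by apply/subsetP=> z; rewrite !inE => c; apply: connect_trans c (connect1 e).
exists y; rewrite !inE //.
by have /forallP/(_ x)/forallP/(_ y)/implyP/(_ e) := dG.
Qed.

Lemma dag_Gps G : is_dag G -> exists s, G \in Gps s.
Proof.
case/dag_rank=> f fP; set l := sort (relpre f leq) (enum 'I_p).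
have ul : uniq l by rewrite sort_uniq enum_uniq.
have sl : size l = p by rewrite size_sort size_enum_ord.
have meml x : x \in l by rewrite mem_sort mem_enum.
have lt x : index x l < p by rewrite -{2}sl index_mem.
have inj : injective (fun x => Ordinal (lt x)).
  by move=> x y /(congr1 val)/=; apply: index_inj.
(* [perm inj] sends a node to its position in the list sorted by rank; an ordering sends positions
   to nodes, hence the inverse. *)
exists (perm inj)^-1%g; apply/in_Gps=> x y e; rewrite invgK !permE /=.
rewrite ltnNge; apply/negP=> le.
have tr : transitive (relpre f leq) by move=> ? ? ?; apply: leq_trans.
have so : sorted (relpre f leq) l by apply: sort_sorted => ? ?; apply: leq_total.
have rf : reflexive (relpre f leq) by move=> ?; apply: leqnn.
have := sorted_leq_index tr rf so _ _ (meml y) (meml x) le.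
by rewrite /= leqNgt fP.
Qed.

Lemma min_imap_Gps G s : min_imap G s \in Gps s.
Proof. by apply/in_Gps=> x y; rewrite /edge inE /= inE => /andP[]. Qed.

(* v is a sink of the ancestral set B, so its neighbours in the moral graph of
   B are exactly its parents. *)
Lemma mconn_parent G s u v : is_dag G -> u \in preds s v ->
  (forall x y, edge G x y -> y \in v |: preds s v -> x \in preds s v) ->
  mconn G (preds s v :\ u) u v = edge G u v.
Proof.
move=> dG uv clB; have vP : v \notin preds s v by rewrite inE ltnn.
have vu : v == u = false by apply/negP=> /eqP eqvu; rewrite {1}eqvu uv in vP.
have ancB : anc G (u |: (v |: preds s v :\ u)) \subset v |: preds s v.
  apply: anc_sub => [|x y e /(clB _ _ e) xP]; last by rewrite inE xP orbT.
  by rewrite !subUset !sub1set setU11 setU1r //= (subset_trans (subsetDl _ _)) ?subsetUr.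
apply/idP/idP=> [|e]; last first.
  apply: connect1; rewrite /mrel /moral e !inE vu eqxx ltnn /= !andbT.
  by apply/andP; split; apply/existsP; [exists u|exists v]; rewrite !inE eqxx ?orbT connect0.
apply: contraLR => ne; apply/negP; rewrite /mconn; set r := mrel _ _ _ => c.
suff cl : closed r (pred1 u).
  by have := closed_connect cl c; rewrite !inE eqxx vu.
apply: intro_closed => [|x y]; first exact: mrel_sym.
rewrite !inE => m /eqP eqx; move: m; rewrite {x}eqx => /and3P[_ /setDP[/(subsetP ancB) yB yC] m].
apply: contraR yC; rewrite !inE => -> /=.
have : y \in preds s v; last by rewrite inE.
case/setU1P: yB m => // -> /or3P[e|e|/existsP[w /and3P[/(subsetP ancB) wB e1 e2]]].
- by rewrite e in ne.
- exact: clB e (setU1r _ uv).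
- exact: clB e2 wB.
Qed.

(** For an ordering of G itself every set of predecessors is ancestral, so [mconn_parent] applies to
    all pairs. *)
Lemma min_imap_id G s : G \in Gps s -> min_imap G s = G.
Proof.
move=> Gs; have dG := Gps_dag Gs; move/in_Gps: Gs => Gs.
apply/setP=> -[u v]; rewrite min_imapE //.
have [uv|uv] := boolP (u \in preds s v); last first.
  by apply/esym; apply: contraNF uv => /Gs; rewrite inE.
rewrite mconn_parent // => x y e; rewrite !inE; move/Gs: e => lt /orP[/eqP <- //|].
exact: ltn_trans.
Qed.

Lemma imap_min_imap G K s : is_dag G -> is_dag K -> imap G K ->
  min_imap G s \subset min_imap K s.
Proof.
move=> dG dK GK; apply/subsetP=> -[u v]; rewrite !min_imapE // => /andP[uv c].
by rewrite uv GK // !inE ?eqxx ?ltnn ?andbF.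
Qed.

Lemma mem_eq_class G : is_dag G -> G \in eq_class G.
Proof. by move=> dG; rewrite inE dG; apply/asboolP => A B C. Qed.

Lemma eq_class_eq G K : is_dag G -> is_dag K -> markov_equiv G K ->
  eq_class G = eq_class K.
Proof.
move=> dG dK e; apply/setP=> H; rewrite !inE; congr andb; apply/asboolP/asboolP => e' A B C h1 h2 h3.
  by have [? ?] := e A B C h1 h2 h3; have [? ?] := e' A B C h1 h2 h3; split; auto.
by have [? ?] := e A B C h1 h2 h3; have [? ?] := e' A B C h1 h2 h3; split; auto.
Qed.

End Imap.

(** * Covered edge reversals *)

Lemma connect_bypass (T : finType) (r r' : rel T) (y a b : T) :
  (forall x z, x != y -> z != y -> r x z -> connect r' x z) ->
  (forall x z, x != y -> z != y -> r x y -> r y z -> connect r' x z) ->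
  a != y -> b != y -> connect r a b -> connect r' a b.
Proof.
move=> r1 r2 ay + /connectP[q pq lq]; rewrite {b}lq => ly.
(* The second conjunct serves a path that currently stands at y: the node x before y is remembered
   and joined directly to the node after y. *)
suff [H _] : (a != y -> connect r' a (last a q)) /\
    (forall x, x != y -> r x y -> a = y -> connect r' x (last a q)) by exact: H.
elim: q a pq ly {ay} => [|w q IH] a /=; first by move=> _ ly; split=> // x _ _ /eqP; rewrite (negPf ly).
move=> /andP[raw pq] ly; have [IH1 IH2] := IH w pq ly.
split=> [ay|x xy rx ay]; have [wy|wy] := eqVneq w y.
- by apply: IH2; rewrite // -wy.
- exact: connect_trans (r1 _ _ ay wy raw) (IH1 wy).
- exact: IH2.
by apply: connect_trans (IH1 wy); apply: r2 => //; rewrite -ay.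
Qed.

Section Covered.
Variable p : nat.
Implicit Types (G H K : digraph p) (A B C : {set 'I_p}) (a b x y z : 'I_p) (s : 'S_p).

Definition covered G y z := edge G y z && (Pa G z == y |: Pa G y).

Definition rev_edge G y z : digraph p := (z, y) |: (G :\ (y, z)).

Definition cov_step : rel (digraph p) := fun G K =>
  [&& is_dag G, is_dag K & [exists y, exists z, covered G y z && (K == rev_edge G y z)]].

Lemma edge_rev G y z u v : edge (rev_edge G y z) u v =
  (u == z) && (v == y) || (~~ ((u == y) && (v == z)) && edge G u v).
Proof. by rewrite /edge !inE !xpair_eqE. Qed.

Lemma cov_stepP G K : reflect (exists y z,
    [/\ is_dag G, is_dag K, edge G y z,
        (forall x, edge G x z = (x == y) || edge G x y) & K = rev_edge G y z])
  (cov_step G K).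
Proof.
apply: (iffP and3P) => [[dG dK /existsP[y /existsP[z /andP[/andP[e /eqP c] /eqP eK]]]]|].
  by exists y, z; split=> // x; have /setP/(_ x) := c; rewrite !inE.
case=> y [z [dG dK e c eK]]; split=> //; apply/existsP; exists y; apply/existsP; exists z.
by rewrite /covered e eK eqxx andbT; apply/eqP/setP=> x; rewrite !inE; apply: c.
Qed.

(** The reversed edge is covered again, and reversing it restores G. By this symmetry, the I-map
    property in one direction yields Markov equivalence. *)
Lemma cov_step_sym : symmetric cov_step.
Proof.
suff H G K : cov_step G K -> cov_step K G by move=> G K; apply/idP/idP; apply: H.
case/cov_stepP=> y [z [dG dK e c eK]]; apply/cov_stepP; exists z, y.
have yz : y == z = false by apply: contraTF e => /eqP->; rewrite dag_irr.
have zy : edge G z y = false by apply: dag_asym.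
split=> // [|x|].
- by rewrite eK edge_rev !eqxx.
- rewrite eK !edge_rev eqxx yz !(andbT, andbF) /= c.
  rewrite eqxx andbT; have [->|_] := eqVneq x y; first by rewrite yz dag_irr.
  by case: (x == z).
apply/setP=> u; rewrite eK !inE; have [->|_] := eqVneq u (y, z); first exact: e.
by have [->|_] := eqVneq u (z, y).
Qed.

Lemma cov_step_card G K : cov_step G K -> #|K| = #|G|.
Proof.
case/cov_stepP=> y [z [dG dK e c ->]].
rewrite cardsU1 !inE [(z, y) \in G](dag_asym dG e) andbF /=.
by rewrite [in RHS](cardsD1 (y, z)) [(y, z) \in G]e.
Qed.

Lemma cov_step_adjacent G K x w : cov_step G K -> adjacent K x w = adjacent G x w.
Proof.
case/cov_stepP=> y [z [dG dK e c ->]]; rewrite /adjacent !edge_rev.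
rewrite [(w == z) && _]andbC [(w == y) && _]andbC.
have [/andP[/eqP-> /eqP->]|_] := boolP ((x == y) && (w == z)); first by rewrite e orbT.
by have [/andP[/eqP-> /eqP->]|_] := boolP ((x == z) && (w == y)); rewrite ?e ?orbT.
Qed.

(* If z is in the ancestral set of the reversed graph but y is not, then y is
   only used to pass between vertices of the clique formed by z and its
   parents, and can be bypassed. *)
Lemma cov_step_imap G K : cov_step G K -> imap G K.
Proof.
case/cov_stepP=> y [z [dG dK eyz c ->]] C a b aC bC; rewrite /mconn.
set L := rev_edge G y z; set T := a |: _; set A := anc G T; set A' := anc L T.
have GL u v : edge G u v -> ~~ ((u == y) && (v == z)) -> edge L u v.
  by move=> e n; rewrite edge_rev n e orbT.
have Lzy : edge L z y by rewrite edge_rev !eqxx.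
have Ly u : edge G u y -> edge L u y.
  by move=> e; apply: GL => //; apply: contraTN e => /andP[/eqP-> _]; rewrite dag_irr.
have Lz u : u != y -> edge G u z -> edge L u z by move=> ne e; apply: GL; rewrite // (negPf ne).
have aT : a \in T by rewrite setU11.
have bT : b \in T by rewrite setU1r ?setU11.
have TA' : T \subset A' by exact: sub_anc.
have [/andP[zA' yA']|ok] := boolP ((z \in A') && (y \notin A')); last first.
  (* Here the ancestral set can only grow and moral edges survive. Of two nodes joined through their
     common child z, either one is y and the other a parent of y, or both keep their edges to z. *)
  have yA' : z \in A' -> y \in A' by move=> zA'; apply: contraR ok => ->; rewrite zA'.
  have sAA : A \subset A'.
    apply: anc_sub => // u v e vA; have [/andP[/eqP-> /eqP vz]|n] := boolP ((u == y) && (v == z)).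
      by apply: yA'; rewrite -vz.
    exact: anc_closed (GL _ _ e n) vA.
  apply: connect_sub => u v /and3P[/setDP[uA uC] /setDP[vA vC] m].
  have [->|uv] := eqVneq u v; first exact: connect0.
  apply: connect1; rewrite /mrel !in_setD uC vC !(subsetP sAA) //=.
  case/or3P: m => [e|e|/existsP[w /and3P[wA e1 e2]]].
  - have [/andP[/eqP-> /eqP->]|n] := boolP ((u == y) && (v == z)); rewrite /moral ?Lzy ?orbT //.
    by rewrite (GL _ _ e n).
  - have [/andP[/eqP-> /eqP->]|n] := boolP ((v == y) && (u == z)); rewrite /moral ?Lzy ?orbT //.
    by rewrite (GL _ _ e n) orbT.
  have [wz|wz] := eqVneq w z; last first.
    apply/or3P/Or33/existsP; exists w; rewrite (subsetP sAA) //=.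
    by rewrite !GL // (negPf wz) andbF.
  rewrite wz !c in e1 e2 wA; have [uy|uy] := eqVneq u y.
    rewrite uy in uv e2 *; rewrite eq_sym (negPf uv) /= in e2.
    by rewrite /moral (Ly _ e2) orbT.
  rewrite (negPf uy) /= in e1; have [vy|vy] := eqVneq v y.
    by rewrite vy /moral (Ly _ e1).
  rewrite (negPf vy) /= in e2; apply/or3P/Or33/existsP; exists z.
  by rewrite (subsetP sAA) //= !Lz // c ?e1 ?e2 orbT.
have sAA : A \subset y |: A'.
  apply: anc_sub => [|u v e]; first exact: subset_trans TA' (subsetUr _ _).
  rewrite !in_setU1; have [//|uy] := eqVneq u y.
  case/orP=> [/eqP vy|vA'].
    by apply: (@anc_closed _ L T u z _ zA'); apply: Lz; rewrite // c -vy e orbT.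
  by apply: (anc_closed _ vA'); apply: GL; rewrite // (negPf uy).
have AA' u : u != y -> u \in A -> u \in A'.
  by move=> uy /(subsetP sAA)/setU1P[/eqP|//]; rewrite (negPf uy).
have noy w : edge G y w -> w \in A -> w = z.
  move=> e wA; apply/eqP; apply: contraR yA' => wz.
  have wy : w != y by apply: contraTneq e => ->; rewrite dag_irr.
  by apply: (anc_closed _ (AA' _ wy wA)); apply: GL; rewrite // negb_and wz orbT.
have nb x : x != y -> mrel G A C x y -> x = z \/ edge L x z.
  move=> xy /and3P[/setDP[xA _] _ /or3P[e|e|/existsP[w /and3P[wA e1 e2]]]].
  - by right; apply: Lz; rewrite // c e orbT.
  - by left; apply: noy.
  - by right; apply: Lz => //; rewrite -(noy w).
apply: (@connect_bypass _ _ _ y).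
- move=> u v uy vy /and3P[/setDP[uA uC] /setDP[vA vC] m]; apply: connect1.
  rewrite /mrel !in_setD uC vC !AA' //=; case/or3P: m => [e|e|/existsP[w /and3P[wA e1 e2]]].
  + by rewrite /moral GL // (negPf uy).
  + by rewrite /moral (GL v u) ?orbT // (negPf vy).
  apply/or3P/Or33/existsP; have [wy|wy] := eqVneq w y.
    by exists z; rewrite wy in e1 e2; rewrite zA' /= !Lz // c ?e1 ?e2 orbT.
  by exists w; rewrite AA' //= !GL // ?(negPf uy) ?(negPf vy).
- move=> u v uy vy m1; have [nu uAC] : (u = z \/ edge L u z) /\ u \in A' :\: C.
    by split; [exact: nb|case/and3P: m1 => /setDP[uA uC] _ _; rewrite in_setD uC AA'].
  have sy : symmetric (mrel G A C) by move=> ? ?; rewrite /mrel moral_sym andbCA.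
  rewrite sy => m2; have [nv vAC] : (v = z \/ edge L v z) /\ v \in A' :\: C.
    by split; [exact: nb|case/and3P: m2 => /setDP[vA vC] _ _; rewrite in_setD vC AA'].
  have [->|uv] := eqVneq u v; first exact: connect0.
  apply: connect1; rewrite /mrel uAC vAC /moral /=.
  case: nu nv => [uz|e1] [vz|e2].
  + by rewrite uz vz eqxx in uv.
  + by rewrite uz e2 orbT.
  + by rewrite vz e1.
  by apply/or3P/Or33/existsP; exists z; rewrite zA' e1.
- by apply: contraNneq yA' => <-; apply: (subsetP TA').
- by apply: contraNneq yA' => <-; apply: (subsetP TA').
Qed.

Lemma coveq_sym : connect_sym cov_step.
Proof. exact/sym_connect_sym/cov_step_sym. Qed.

Lemma coveq_ind (P : digraph p -> Prop) G K :
  (forall H L, cov_step H L -> P H -> P L) -> P G -> connect cov_step G K -> P K.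
Proof.
move=> st + /connectP[q pq ->]; elim: q G pq => //= L q IH G /andP[e pq] PG.
by apply: IH pq _; apply: st PG.
Qed.

Lemma coveq_imap G K : connect cov_step G K -> imap G K.
Proof.
apply: coveq_ind (@imap_refl _ G) => H L /cov_step_imap HL GH; exact: imap_trans HL.
Qed.

Lemma coveq_card G K : connect cov_step G K -> #|K| = #|G|.
Proof. by apply: (@coveq_ind (fun H => #|H| = #|G|)) => // H L /cov_step_card->. Qed.

Lemma coveq_adjacent G K x y : connect cov_step G K -> adjacent K x y = adjacent G x y.
Proof.
by apply: (@coveq_ind (fun H => adjacent H x y = adjacent G x y)) => // H L /cov_step_adjacent->.
Qed.

Lemma coveq_markov_equiv G K : is_dag G -> is_dag K -> connect cov_step G K ->
  markov_equiv G K.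
Proof.
move=> dG dK c; apply: imap_markov_equiv => //; apply: coveq_imap; rewrite // coveq_sym.
exact: c.
Qed.

End Covered.

(** * From a graph to its minimal I-maps *)

Section Pull.
Variable p : nat.
Implicit Types (H K : digraph p) (A B C : {set 'I_p}) (a b x : 'I_p) (s : 'S_p).
Variables (G : digraph p) (y z : 'I_p).
Hypotheses (dG : is_dag G) (eyz : edge G y z)
  (only_path : forall w, edge G y w -> connect (edge G) w z -> w = z).

(** The common parents that make y -> z covered: [cover_edge] adds the missing ones, and [pull_edge]
    then reverses y -> z. *)
Definition cover_pa : {set 'I_p} := (Pa G y :|: Pa G z) :\ y.

Definition cover_edge : digraph p :=
  set_parents (set_parents G y cover_pa) z (y |: cover_pa).

Definition pull_edge : digraph p :=
  set_parents (set_parents G y (z |: cover_pa)) z cover_pa.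

Let yz : y == z = false.
Proof. by apply: contraTF eyz => /eqP->; rewrite dag_irr. Qed.

Lemma in_Ch H u v : (v \in Ch H u) = edge H u v.
Proof. by rewrite inE. Qed.

Lemma edge_set_parents H j S u v :
  edge (set_parents H j S) u v = if v == j then u \in S else edge H u v.
Proof. by rewrite /edge inE. Qed.

Lemma edge_cover u v : edge cover_edge u v =
  if v == z then u \in y |: cover_pa else if v == y then u \in cover_pa else edge G u v.
Proof. by rewrite !edge_set_parents. Qed.

Lemma edge_pull u v : edge pull_edge u v =
  if v == z then u \in cover_pa else if v == y then u \in z |: cover_pa else edge G u v.
Proof. by rewrite !edge_set_parents. Qed.

Lemma in_cover_pa u : u \in cover_pa = (u != y) && (edge G u y || edge G u z).
Proof. by rewrite !inE. Qed.

Lemma sub_cover : G \subset cover_edge.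
Proof.
apply/subsetP=> -[u v]; rewrite -![_ \in _]/(edge _ u v) edge_cover in_setU1 in_cover_pa => e.
have [vz|_] := eqVneq v z; first by rewrite -vz e orbT andbT orbN.
have [vy|//] := eqVneq v y; rewrite -vy e /= andbT.
by apply: contraTneq e => ->; rewrite dag_irr.
Qed.

Lemma dag_connect u v : edge G u v -> ~~ connect (edge G) v u.
Proof. by move=> e; move/forallP/(_ u)/forallP/(_ v)/implyP/(_ e): dG. Qed.

(** If a parent u of z were a proper descendant of y, some child w of y would lead through u to z;
    [only_path] gives w = z, and u -> z closes a cycle. *)
Lemma cover_pa_nondesc u : u \in cover_pa -> ~~ connect (edge G) y u.
Proof.
rewrite in_cover_pa => /andP[uy /orP[/dag_connect //|euz]].
apply/negP=> /connectP[[|w q] /=]; first by move=> _ eq; rewrite eq eqxx in uy.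
move=> /andP[eyw pq] lq; have cwu : connect (edge G) w u by apply/connectP; exists q.
have wz : w = z by apply: only_path => //; apply: connect_trans cwu (connect1 euz).
by have := dag_connect euz; rewrite -wz cwu.
Qed.

(* Since no other directed path leads from y to z, these two can be made
   consecutive in an ordering, just after all non-descendants of y. *)
Lemma pull_rank (c : nat) (H : digraph p) :
  c <= 1 ->
  (forall u v, edge H u v -> v != y -> v != z -> edge G u v) ->
  (forall u, edge H u y -> u \in cover_pa \/ u = z /\ c = 1) ->
  (forall u, edge H u z -> u \in cover_pa \/ u = y /\ c = 0) ->
  is_dag H.
Proof.
move=> c1 Hv Hy Hz; have [f fP] := dag_rank dG.
pose M := (\max_x f x).+1; have fM x : f x < M by rewrite ltnS leq_bigmax.
(* Non-descendants of y keep their rank, below M. Then come y and z at M and M + 1, with y first for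
   c = 0 and z first for c = 1, and the other descendants of y follow. *)
pose g x := if ~~ connect (edge G) y x then f x else
  if x == y then M + c else if x == z then M + (1 - c) else M + 2 + f x.
have gz : g z = M + (1 - c) by rewrite /g connect1 //= eq_sym yz eqxx.
have gy : g y = M + c by rewrite /g connect0 /= eqxx.
have gL u : u \in cover_pa -> g u < M by move/cover_pa_nondesc; rewrite /g => ->.
apply: (@topological_rank _ _ g) => u v e; have [vy|vy] := eqVneq v y.
  rewrite vy gy; rewrite vy in e; case: (Hy _ e) => [/gL|[-> c1']]; first by lia.
  by rewrite gz; lia.
have [vz|vz] := eqVneq v z.
  rewrite vz gz; rewrite vz in e; case: (Hz _ e) => [/gL|[-> c0]]; first by lia.
  by rewrite gy; lia.
have {}e := Hv _ _ e vy vz; have lt := fP _ _ e.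
rewrite {2}/g (negPf vy) (negPf vz); case: ifP => [cv|_].
  rewrite /g ifT //; apply: contra cv => cu; exact: connect_trans cu (connect1 e).
rewrite /g; have := fM u; case: ifP => _; first by lia.
by case: ifP => _; [lia | case: ifP => _; lia].
Qed.

Lemma cover_dag : is_dag cover_edge.
Proof.
apply: (@pull_rank 0) => // [u v|u|u]; rewrite edge_cover.
- by move=> + vy vz; rewrite (negPf vy) (negPf vz).
- by rewrite yz eqxx; left.
- by rewrite eqxx => /setU1P[->|]; [right|left].
Qed.

Lemma pull_dag : is_dag pull_edge.
Proof.
apply: (@pull_rank 1) => // [u v|u|u]; rewrite edge_pull.
- by move=> + vy vz; rewrite (negPf vy) (negPf vz).
- by rewrite yz eqxx => /setU1P[->|]; [right|left].
- by rewrite eqxx; left.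
Qed.

Lemma cov_step_pull : cov_step cover_edge pull_edge.
Proof.
apply/cov_stepP; exists y, z; split; rewrite ?cover_dag ?pull_dag //.
- by rewrite edge_cover eqxx setU11.
- by move=> x; rewrite !edge_cover eqxx yz eqxx in_setU1.
apply/setP=> -[u v]; rewrite -![_ \in _]/(edge _ u v) edge_rev edge_pull edge_cover.
have yN : y \notin cover_pa by rewrite in_cover_pa eqxx.
have [->|vz] := eqVneq v z.
  rewrite [z == y]eq_sym yz andbF andbT /= in_setU1.
  by have [->|] := eqVneq u y; rewrite ?(negPf yN).
have [_|_] := eqVneq v y; last by rewrite !andbF.
by rewrite in_setU1 andbT andbF.
Qed.

(** The child z is lost and none is gained; this is the measure of the inner induction in
    [reducible_partial]. *)
Lemma card_Ch_pull : #|Ch pull_edge y| < #|Ch G y|.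
Proof.
have yN : y \notin cover_pa by rewrite in_cover_pa eqxx.
apply: proper_card; apply/properP; split.
  apply/subsetP=> w; rewrite !in_Ch edge_pull.
  rewrite in_setU1 yz (negPf yN) /=; case: ifP => // _; case: ifP => //.
by exists z; rewrite in_Ch // edge_pull eqxx.
Qed.

Section Ordering.
Variable s : 'S_p.
Local Notation pos x := (nat_of_ord ((s^-1)%g x)).
Hypotheses (late : forall u v, edge G u v -> pos y < pos u -> pos u < pos v)
  (pos_z : pos z < pos y).

Lemma cover_pa_early u : u \in cover_pa -> pos u <= pos y.
Proof.
rewrite in_cover_pa leqNgt => /andP[_ /orP[] /late lt]; apply/negP=> l; have := lt l; lia.
Qed.

Lemma pull_late u v : edge pull_edge u v -> pos y < pos u -> pos u < pos v.
Proof.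
rewrite edge_pull; case: ifP => _; first by move/cover_pa_early; lia.
case: ifP => _; last exact: late.
by case/setU1P=> [->|/cover_pa_early]; lia.
Qed.

(** A parent of v or of a predecessor of v either precedes its child or comes no later than y, which
    is before v; so the predecessors of v form an ancestral set. *)
Lemma late_preds H u v : is_dag H ->
  (forall u v, edge H u v -> pos y < pos u -> pos u < pos v) ->
  pos y < pos v -> u \in preds s v -> mconn H (preds s v :\ u) u v = edge H u v.
Proof.
move=> dH lateH yv uv; apply: mconn_parent => // a b e.
rewrite !inE => b_le; have {b_le} : pos b <= pos v.
  by case/orP: b_le => [/eqP->//|/ltnW].
by have := lateH _ _ e; lia.
Qed.

Variable d : 'I_p.
Hypotheses (zd : connect (edge G) z d)
  (first_d : forall x, connect (edge G) y x -> x != y -> pos d <= pos x).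

(* For an early v, the pulled graph has new moral edges only among y and its
   neighbours, and a path can be sent through y, which comes after all
   predecessors of v. *)
Lemma min_imap_pull : min_imap pull_edge s \subset min_imap G s.
Proof.
apply/subsetP=> -[u v]; rewrite !min_imapE ?pull_dag // => /andP[uv]; rewrite uv /=.
have [yv|vy] := ltnP (pos y) (pos v).
  rewrite !late_preds ?pull_dag //; last exact: pull_late.
  rewrite edge_pull; have [vz|_] := eqVneq v z; first by rewrite vz in yv; lia.
  by have [vy|//] := eqVneq v y; rewrite vy in yv; lia.
set C := preds s v :\ u; rewrite /mconn; set T := u |: _.
have yC : y \notin C by rewrite !inE negb_and -leqNgt vy orbT.
set A := anc G T; set A1 := anc pull_edge T.
(* T consists of v and its predecessors. If it contains a descendant of y, it contains the first
   one, d, and z is an ancestor of d. For the descendant y itself, z comes earlier and d no later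
   than z. *)
have yzA : y \in A -> z \in A.
  move=> yA; suff dT : d \in T by apply: (anc_connect zd); apply: (subsetP (sub_anc _ _)).
  have dv : pos d <= pos v.
    move: yA; rewrite inE => /existsP[t /andP[tT yt]].
    have tv : pos t <= pos v.
      move: uv tT; rewrite !inE => uv /or3P[/eqP->|/eqP->|/andP[_]]; lia.
    have [ty|ty] := eqVneq t y; last by apply: leq_trans (first_d yt ty) tv.
    have zy : z != y by rewrite eq_sym yz.
    have := first_d (connect1 eyz) zy; move: pos_z; rewrite -ty; lia.
  rewrite !inE; have [//|_] := eqVneq d u; have [//|dv'] := eqVneq d v.
  rewrite /= ltn_neqAle dv andbT; apply: contra dv' => /eqP/val_inj/perm_inj->.
  exact: eqxx.
have NA x : y \in A -> x \in z |: cover_pa -> x \in A.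
  move=> yA /setU1P[->|]; first exact: yzA.
  by rewrite in_cover_pa => /andP[_ /orP[]/anc_closed]; apply; rewrite ?yzA.
have zyA : z \in A -> y \in A by apply: anc_closed.
have sA : A1 \subset A.
  apply: anc_sub => [|a b]; first exact: sub_anc.
  rewrite edge_pull; have [->|_] := eqVneq b z; last first.
    by have [-> e yA|_] := eqVneq b y; [apply: NA|apply: anc_closed].
  by move=> e /zyA yA; apply: NA; rewrite // setU1r.
have hub x : y \in A -> x \in A -> x \notin C -> x \in z |: cover_pa -> mrel G A C x y.
  move=> yA xA xC xN; apply/and3P; split; [exact/setDP | exact/setDP |].
  case/setU1P: xN => [->|]; first by rewrite /moral eyz orbT.
  rewrite in_cover_pa => /andP[_ /orP[e|e]]; first by rewrite /moral e.
  by apply/or3P/Or33/existsP; exists z; rewrite yzA //= e.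
have hubs a b : y \in A -> a \in A :\: C -> b \in A :\: C ->
    a \in y |: (z |: cover_pa) -> b \in y |: (z |: cover_pa) -> connect (mrel G A C) a b.
  move=> yA /setDP[aA aC] /setDP[bA bC] aN bN; apply: (@connect_trans _ _ y).
    by case/setU1P: aN => [->|/hub h]; [exact: connect0 | apply: connect1; exact: h].
  rewrite mrel_sym.
  by case/setU1P: bN => [->|/hub h]; [exact: connect0 | apply: connect1; exact: h].
apply: connect_sub => a b /and3P[/setDP[/(subsetP sA) aA aC] /setDP[/(subsetP sA) bA bC] m].
have aAC : a \in A :\: C by exact/setDP.
have bAC : b \in A :\: C by exact/setDP.
have direct x w : edge pull_edge x w -> w != y -> w != z -> edge G x w.
  by move=> + wy wz; rewrite edge_pull (negPf wy) (negPf wz).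
have into x w : edge pull_edge x w -> w = y \/ w = z ->
    (x \in y |: (z |: cover_pa)) && (w \in y |: (z |: cover_pa)).
  rewrite edge_pull => e wyz; apply/andP; split.
    by move: e; case: wyz => ->; rewrite ?yz eqxx => e; rewrite !in_setU1 ?e ?orbT //;
       move: e; rewrite in_setU1 => ->; rewrite orbT.
  by case: wyz => ->; rewrite !in_setU1 eqxx ?orbT.
have inA w : w \in A -> w = y \/ w = z -> y \in A.
  by move=> wA [eqw|eqw]; rewrite eqw in wA => //; apply: zyA.
have split w : w = y \/ w = z \/ (w != y) && (w != z).
  by have [->|wy] := eqVneq w y; [left|have [->|wz] := eqVneq w z; right; [left|right]].
case/or3P: m => [e|e|/existsP[w /and3P[/(subsetP sA) wA e1 e2]]].
- case: (split b) => [byz|[byz|/andP[by_ bz]]].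
  + by have /andP[aN bN] := into _ _ e (or_introl byz); apply: hubs; rewrite // -byz.
  + have /andP[aN bN] := into _ _ e (or_intror byz); apply: hubs => //.
    by apply: zyA; rewrite -byz.
  by apply: connect1; rewrite /mrel aAC bAC /moral direct.
- case: (split a) => [byz|[byz|/andP[by_ bz]]].
  + by have /andP[bN aN] := into _ _ e (or_introl byz); apply: hubs; rewrite // -byz.
  + have /andP[bN aN] := into _ _ e (or_intror byz); apply: hubs => //.
    by apply: zyA; rewrite -byz.
  by apply: connect1; rewrite /mrel aAC bAC /moral (direct _ _ e by_ bz) orbT.
case: (boolP ((w == y) || (w == z))) => [wyz|]; last first.
  rewrite negb_or => /andP[wy wz]; apply: connect1; rewrite /mrel aAC bAC.
  by apply/or3P/Or33/existsP; exists w; rewrite wA /= !direct.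
have {}wyz : w = y \/ w = z by case/orP: wyz => /eqP; [left|right].
have /andP[aN _] := into _ _ e1 wyz; have /andP[bN _] := into _ _ e2 wyz.
by apply: hubs => //; apply: inA wA wyz.
Qed.

End Ordering.
End Pull.

(** * Edge additions and covered reversals leading to a minimal I-map *)

Section Chain.
Variable p : nat.
Implicit Types (G H K : digraph p) (s : 'S_p).

(** What is remembered of a sequence of additions and covered reversals from G to H: only its last
    addition, from [H0] to [H1], if there is any. *)
Definition reducible_to G H : Prop := connect (@cov_step p) G H \/
  exists H0 H1, [/\ is_dag H0, is_dag H1, H0 \proper H1, imap G H0
    & connect (@cov_step p) H1 H].

Lemma reducible_add G K H : is_dag G -> is_dag K -> G \subset K ->
  reducible_to K H -> reducible_to G H.
Proof.
move=> dG dK sGK [c|[H0 [H1 [d0 d1 pr im c]]]].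
  have [->|GK] := eqVneq G K; first by left.
  by right; exists G, K; split=> //; rewrite properEneq GK.
by right; exists H0, H1; split=> //; apply: imap_trans (sub_imap sGK) im.
Qed.

Lemma reducible_rev G K H : cov_step G K -> reducible_to K H -> reducible_to G H.
Proof.
move=> st [c|[H0 [H1 [d0 d1 pr im c]]]]; first by left; apply: connect_trans (connect1 st) c.
by right; exists H0, H1; split=> //; apply: imap_trans (cov_step_imap st) im.
Qed.

(** Outer induction on m, the number of initial positions whose outgoing edges may go backwards;
    inner induction on the number of children of the last such node y. For m = 0, G is its own
    minimal I-map, so it is contained in H and one addition finishes. *)
Lemma reducible_partial s m G H : is_dag G -> H \in Gps s ->
  (forall x y, edge G x y -> m <= (s^-1)%g x -> (s^-1)%g x < (s^-1)%g y) ->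
  min_imap G s \subset H -> reducible_to G H.
Proof.
move=> dG Hs; elim: m G dG => [|m IHm] G dG late sub.
  have Gs : G \in Gps s by apply/in_Gps => x y /late; apply.
  rewrite (min_imap_id Gs) in sub; apply: reducible_add sub _ => //; last by left.
  exact: Gps_dag Hs.
have [mp|pm] := ltnP m p; last first.
  by apply: (IHm G) => // x y e le; have := ltn_ord ((s^-1)%g x); lia.
pose y := s (Ordinal mp); have posy : (s^-1)%g y = Ordinal mp by rewrite permK.
have [n] := ubnP #|Ch G y|; elim: n G dG late sub => // n IHn G dG late sub ch.
have late' u v : edge G u v -> (s^-1)%g y < (s^-1)%g u -> (s^-1)%g u < (s^-1)%g v.
  by rewrite posy; apply: late.
have [/existsP[z0 /andP[e0 lt0]]|nex] :=
  boolP [exists z0, edge G y z0 && ((s^-1)%g z0 < (s^-1)%g y)]; last first.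
  apply: (IHm G) => // u v e; rewrite leq_eqVlt => /orP[/eqP eqm|]; last exact: late.
  have uy : u = y by apply: (@perm_inj _ (s^-1)%g); rewrite posy; apply: val_inj; rewrite /= -eqm.
  rewrite uy in e *; move/existsPn/(_ v): nex; rewrite e /= -leqNgt leq_eqVlt.
  case/orP=> // /eqP/val_inj/perm_inj eqv; by rewrite eqv dag_irr in e.
have ne0 : z0 != y by apply: contraTneq lt0 => ->; rewrite ltnn.
pose P x := connect (edge G) y x && (x != y).
have P0 : P z0 by rewrite /P connect1.
case: (arg_minnP (fun x => (s^-1)%g x : nat) P0) => d /andP[yd dy] mind.
have [f fP] := dag_rank dG.
have fc a b : connect (edge G) a b -> a != b -> f a < f b.
  case/connectP=> q; elim: q a => [|w q IH] a /=; first by move=> _ ->; rewrite eqxx.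
  move=> /andP[/fP faw pq] lq _; have [<-//|wb] := eqVneq w b.
  exact: ltn_trans faw (IH w pq lq wb).
have [w ew] : exists w, edge G y w && connect (edge G) w d.
  case/connectP: yd => [[|w q]] /=; first by move=> _ eq; rewrite eq eqxx in dy.
  by move=> /andP[e pq] lq; exists w; rewrite e; apply/connectP; exists q.
(* Among the children of y leading to d, z has least rank in G. A child of y leading to z also leads
   to d, hence is z itself. *)
case: (@arg_minnP _ w (fun w => edge G y w && connect (edge G) w d) f ew) => z /andP[eyz zd] minz {w ew}.
have zy : z != y by apply: contraTneq eyz => ->; rewrite dag_irr.
have dz0 : (s^-1)%g d <= (s^-1)%g z0 by apply: (mind z0).
(* Since d is no later than [z0], it precedes y, whereas a directed path starting after y stays
   after y. *)
have posz : (s^-1)%g z < (s^-1)%g y.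
  rewrite ltnNge leq_eqVlt; apply/negP=> /orP[/eqP/val_inj/perm_inj eqz|lt].
    by rewrite eqz eqxx in zy.
  suff : (s^-1)%g y < (s^-1)%g d by move=> lt'; have := leq_ltn_trans dz0 lt0; lia.
  case/connectP: zd => q; elim: q (z) lt => [|w q IH] v lt /=; first by move=> _ ->.
  by move=> /andP[/late' e pq] lq; apply: (IH w _ pq lq); apply: ltn_trans lt (e lt).
have only w : edge G y w -> connect (edge G) w z -> w = z.
  move=> e c; apply/eqP; apply: contraT => /(fc _ _ c).
  by rewrite ltnNge minz // e (connect_trans c).
apply: (@reducible_add _ (cover_edge G y z)) => //; [exact: cover_dag | exact: sub_cover | ].
apply: reducible_rev (cov_step_pull dG eyz only) _; apply: IHn.
- exact: pull_dag.
- by move=> u v e; rewrite -[m]/(val (Ordinal mp)) -posy; exact: (pull_late dG eyz late' posz e).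
- apply: subset_trans sub; apply: (min_imap_pull dG eyz only late' posz zd) => x yx xy.
  by apply: mind; rewrite /P yx.
exact: leq_trans (card_Ch_pull dG eyz) _.
Qed.

Lemma reducible_min_imap s G : is_dag G -> reducible_to G (min_imap G s).
Proof.
move=> dG; apply: (@reducible_partial s p) => //; first exact: min_imap_Gps.
by move=> x y _; rewrite leqNgt ltn_ord.
Qed.

End Chain.

(** * The operators on equivalence classes *)

Section Counting.
Variable p : nat.
Implicit Types (G H K : digraph p) (s : 'S_p).

Lemma card_Pa G : #|G| = \sum_(j < p) #|Pa G j|.
Proof.
rewrite -sum1_card (partition_big (fun e => e.2) predT) //=.
apply: eq_bigr => j _; rewrite -sum1_card.
rewrite (reindex_onto (fun i => (i, j)) (fun e => e.1)) /=; last first.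
  by case=> a b /= /andP[_ /eqP->].
by apply: eq_bigl => i; rewrite !inE !eqxx !andbT.
Qed.

Lemma card_Ch G : #|G| = \sum_(j < p) #|Ch G j|.
Proof.
rewrite -sum1_card (partition_big (fun e => e.1) predT) //=.
apply: eq_bigr => j _; rewrite -sum1_card.
rewrite (reindex_onto (fun i => (j, i)) (fun e => e.2)) /=; last first.
  by case=> a b /= /andP[_ /eqP->].
by apply: eq_bigl => i; rewrite !inE !eqxx !andbT.
Qed.

Lemma disjoint_Pa_Ch G j : is_dag G -> [disjoint Pa G j & Ch G j].
Proof.
move=> dG; rewrite -setI_eq0; apply/eqP/setP=> i; rewrite !inE.
by apply/negP=> /andP[e1]; have := dag_asym dG e1; rewrite /edge => ->.
Qed.

Lemma leq_dstar G s j : #|Pa (min_imap G s) j :|: Ch (min_imap G s) j| <= dstar G.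
Proof. by apply: leq_trans (leq_bigmax s); apply: leq_trans (leq_bigmax j). Qed.

Lemma handshake G s : 2 * #|min_imap G s| <= dstar G * p.
Proof.
have dQ : is_dag (min_imap G s) by apply: Gps_dag (min_imap_Gps _ _).
rewrite mul2n -addnn {1}card_Pa card_Ch -big_split /=.
apply: (@leq_trans (\sum_(j < p) dstar G)).
  apply: leq_sum => j _; apply: leq_trans (leq_dstar G s j).
  have := leq_card_setU (Pa (min_imap G s) j) (Ch (min_imap G s) j).
  by rewrite disjoint_Pa_Ch // => -[_ /eqP->].
by rewrite sum_nat_const card_ord mulnC.
Qed.

Lemma neighboursE G j : Pa G j :|: Ch G j = [set i | adjacent G i j].
Proof. by apply/setP=> i; rewrite !inE. Qed.

Lemma GpP din dout G : reflect
  [/\ is_dag G, forall j, #|Pa G j| <= din & forall j, #|Ch G j| <= dout]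
  (G \in Gp p din dout).
Proof.
rewrite inE; apply: (iffP and3P) => -[dG h1 h2].
  by split=> // j; [have := forallP h1 j|have := forallP h2 j].
by split=> //; apply/forallP.
Qed.

Definition edge_diff G H := #|H :\: G| + #|G :\: H|.

Lemma edge_diffE G H : edge_diff G H =
  \sum_(j < p) (#|Pa H j :\: Pa G j| + #|Pa G j :\: Pa H j|).
Proof.
rewrite /edge_diff !card_Pa big_split /=.
by congr addn; apply: eq_bigr => j _; congr #|pred_of_set _|; apply/setP=> i; rewrite !inE.
Qed.

Lemma edge_diff_le G H : edge_diff G H <= #|G| + #|H|.
Proof. by rewrite addnC leq_add // subset_leq_card // subsetDl. Qed.

Lemma edge_diff_sub G H : H \subset G -> edge_diff G H = #|G| - #|H|.
Proof.
by move=> s; rewrite /edge_diff (cardsDS s) (eqP (_ : H :\: G == set0)) ?cards0 ?setD_eq0.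
Qed.

Lemma Pa_inj G H : (forall j, Pa G j = Pa H j) -> G = H.
Proof. by move=> e; apply/setP=> -[i j]; have /setP/(_ i) := e j; rewrite !inE. Qed.

End Counting.

(** Every move deletes an element outside Q, adds one of Q, or both. The last clause records that at
    most one parent k is gained, so only k can gain a child. *)
Lemma ads_step_decreases (R : realType) (p din : nat) (f : {set 'I_p} -> R)
    (Q S S' : {set 'I_p}) :
  ads_step f din Q S S' -> #|Q| <= din -> #|S| <= din -> S != Q ->
  [/\ #|S'| <= din, #|Q :\: S'| + #|S' :\: Q| < #|Q :\: S| + #|S :\: Q| &
      S' \subset S \/ exists2 k, k \in Q :\: S & S' \subset k |: S].
Proof.
move=> [_ del add swap] leQ leS neq.
have delS A l : l \notin Q -> Q :\: (A :\ l) = Q :\: A.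
  by move=> lQ; apply/setP=> x; rewrite !inE; have [->|] := eqVneq x l; rewrite ?(negPf lQ) ?andbF.
have delD A l : (A :\ l) :\: Q = (A :\: Q) :\ l by rewrite setDDl setUC -setDDl.
have addS k : Q :\: (k |: S) = (Q :\: S) :\ k by rewrite setUC setDDl.
have addD k : k \in Q -> (k |: S) :\: Q = S :\: Q.
  by move=> kQ; apply/setP=> x; rewrite !inE; have [->|] := eqVneq x k; rewrite ?kQ.
have [sQS|nsQS] := boolP (Q \subset S).
  have [|l [lD _] ->] := del; first by rewrite properEneq eq_sym neq.
  have /setDP[lS lQ] := lD; rewrite (delS _ _ lQ) delD.
  have sub : S :\ l \subset S by apply: subsetDl.
  split; [exact: leq_trans (subset_leq_card sub) leS | | by left].
  by rewrite [#|S :\: Q|](cardsD1 l) lD ltn_add2l.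
have [lt|ge] := ltnP #|S| din.
  have [k [kT _] ->] := add nsQS lt; have /setDP[kQ kS] := kT.
  rewrite addS addD //; split; [by rewrite cardsU1 kS | | by right; exists k].
  by rewrite [#|Q :\: S|](cardsD1 k) kT ltn_add2r.
have eqS : #|S| = din by apply/eqP; rewrite eqn_leq leS.
have [[k l] [/setXP[/= kT lD] _] ->] := swap nsQS eqS.
have /setDP[kQ kS] := kT; have /setDP[lS lQ] := lD; rewrite /=.
rewrite (delS _ _ lQ) addS delD addD //; split; last by right; exists k => //; apply: subsetDl.
  by have := cardsD1 l (k |: S); rewrite cardsU1 kS in_setU1 lS orbT; move/addnI=> <-.
rewrite [#|Q :\: S|](cardsD1 k) [#|S :\: Q|](cardsD1 l) kT lD.
by rewrite addnACA -[X in X < _]add0n ltn_add2r.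
Qed.

(** * Moves of the operators and the distance to the class of [Gstar] *)

Section Progress.
Variables (R : realType) (p : nat) (Gstar : digraph p) (psiloc : 'I_p -> {set 'I_p} -> R).
Variables (din dout : nat) (gn : 'S_p -> 'I_p -> {set 'I_p} -> {set 'I_p}).
Hypotheses (dGstar : is_dag Gstar) (hdin : 0 < din) (hin : dstar Gstar <= din)
  (hout : minn (dstar Gstar * din + 1) p <= dout)
  (hgn : ads_operator psiloc Gstar din gn).
Implicit Types (G H : digraph p) (s : 'S_p).

Local Notation Q s := (min_imap Gstar s).
Local Notation d := (dstar Gstar).

Lemma card_Pa_min s j : #|Pa (Q s) j| <= d.
Proof. exact: leq_trans (subset_leq_card (subsetUl _ _)) (leq_dstar _ _ _). Qed.

Lemma card_Ch_min s j : #|Ch (Q s) j| <= d.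
Proof. exact: leq_trans (subset_leq_card (subsetUr _ _)) (leq_dstar _ _ _). Qed.

Lemma out_bound (A : {set 'I_p}) : #|A| <= d -> #|A| <= dout.
Proof.
move=> leA; have := max_card (mem A); rewrite card_ord => leAp.
apply: leq_trans hout; rewrite leq_min leAp andbT addn1.
by rewrite (leq_trans leA) // (leq_trans (leq_pmulr _ hdin)).
Qed.

Lemma min_imap_Gpsd s : Q s \in Gpsd s din dout.
Proof.
rewrite inE min_imap_Gps; apply/GpP; split=> [|j|j].
- exact: Gps_dag (min_imap_Gps _ _).
- exact: leq_trans (card_Pa_min s j) hin.
- exact/out_bound/card_Ch_min.
Qed.

(* Each j in U wants to acquire a parent k j whose number of children already
   exceeds d * din.  Few of those children can lie outside U, where G agrees
   with the minimal I-map, and the number of edges into U is at most din per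
   node. *)
Lemma saturation_bound s G (k : 'I_p -> 'I_p) :
  let U := [set j | Pa G j != Pa (Q s) j] in
  (forall j, #|Pa G j| <= din) -> U != set0 ->
  (forall j, j \in U -> k j \in Pa (Q s) j :\: Pa G j) ->
  exists2 j, j \in U & #|Ch G (k j)| <= d * din.
Proof.
move=> U inG U0 kP; apply/exists_inP; apply: contraT; rewrite negb_exists_in => /forall_inP big.
pose F := k @: U; pose fib f := [set j in U | k j == f].
have F0 : 0 < #|F| by rewrite card_gt0 imset_eq0.
have leX : \sum_(f in F) #|Ch G f :&: U| <= #|U| * din.
  rewrite (eq_bigr (fun f => \sum_(j in U) (f \in Pa G j))) => [|f _]; last first.
    rewrite -sum1_card big_mkcond /= [RHS]big_mkcond; apply: eq_bigr => j _.
    by rewrite !inE andbC; case: (Pa G j != _) => //=; case: (_ \in G).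
  rewrite exchange_big /= -sum_nat_const; apply: leq_sum => j _.
  apply: leq_trans (inG j); rewrite -sum1_card big_mkcond /= [X in _ <= X]big_mkcond /=.
  by apply: leq_sum => f _; case: (f \in F); case: (f \in Pa G j).
(* The fibre of f under k lies in U, and the children of f outside U are also its children in the
   minimal I-map; together they are at most d nodes. *)
have leY : #|U| + \sum_(f in F) #|Ch G f :\: U| <= #|F| * d.
  have -> : #|U| = \sum_(f in F) #|fib f|.
    rewrite -sum1_card (partition_big k (mem F)) => [|j jU]; last exact: imset_f.
    by apply: eq_bigr => f _; rewrite -sum1_card; apply: eq_bigl => j; rewrite !inE.
  rewrite -big_split -sum_nat_const /=; apply: leq_sum => f _.
  apply: leq_trans (card_Ch_min s f).
  have dis : [disjoint fib f & Ch G f :\: U].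
    by rewrite -setI_eq0; apply/eqP/setP=> j; rewrite !inE; case: (Pa G j != _); rewrite ?andbF.
  have := leq_card_setU (fib f) (Ch G f :\: U); rewrite dis => -[_ /eqP <-].
  apply/subset_leq_card; rewrite subUset; apply/andP; split; apply/subsetP=> j.
    by rewrite inE => /andP[/kP kD /eqP kf]; move: kD; rewrite kf !inE => /andP[].
  by rewrite !inE negbK => /andP[/eqP/setP/(_ f)]; rewrite !inE => ->.
have : \sum_(f in F) (d * din).+1 <= \sum_(f in F) (#|Ch G f :&: U| + #|Ch G f :\: U|).
  by apply: leq_sum => f /imsetP[j jU ->]; rewrite cardsID ltnNge big.
rewrite big_split sum_nat_const /= => le.
move: leX leY le F0; move: (\sum_(f in F) _) (\sum_(f in F) _) #|F| #|U| => x y f u leX leY le F0.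
(* The contradiction is x + y <= (u + y) * din <= f * d * din < f * (d * din + 1) <= x + y. *)
have := leq_mul leY (leqnn din); have := leq_pmulr y hdin; nia.
Qed.

(** If the operator broke the bound on children at every node where the parent sets differ, each
    such node would gain a parent that already has [dout] children, which [saturation_bound] and
    [hout] exclude. *)
Lemma progress s G : G \in Gpsd s din dout -> G != Q s ->
  exists j, [/\ apply_node gn s j G <> G, apply_node gn s j G \in Gpsd s din dout
    & edge_diff (apply_node gn s j G) (Q s) < edge_diff G (Q s)].
Proof.
rewrite inE => /andP[Gs /GpP[dG inG outG]] neq; set U := [set j | Pa G j != Pa (Q s) j].
have U0 : U != set0.
  apply: contra neq => /eqP/setP U0; apply/eqP/Pa_inj => j; apply/eqP.
  by have := U0 j; rewrite !inE => /negbFE.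
have sPa j : Pa G j \subset preds s j.
  by apply/subsetP=> i; rewrite !inE => e; apply: (in_Gps _ _ Gs).
have sPaQ j : Pa (Q s) j \subset preds s j.
  by apply/subsetP=> i; rewrite inE inE /= => /andP[].
pose S' j := gn s j (Pa G j).
have stepP j : j \in U -> [/\ #|S' j| <= din,
    #|Pa (Q s) j :\: S' j| + #|S' j :\: Pa (Q s) j|
      < #|Pa (Q s) j :\: Pa G j| + #|Pa G j :\: Pa (Q s) j| &
    S' j \subset Pa G j \/ exists2 k, k \in Pa (Q s) j :\: Pa G j & S' j \subset k |: Pa G j].
  rewrite inE => neqj; apply: (@ads_step_decreases _ _ _ (psiloc j)); rewrite ?inG //.
    by apply: hgn; rewrite inE sPa inG.
  exact: leq_trans (card_Pa_min s j) hin.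
pose ok j := [forall i, #|Ch (apply_node gn s j G) i| <= dout].
have [j jU /forallP okj] : exists2 j, j \in U & ok j.
  apply/exists_inP; apply: contraT; rewrite negb_exists_in => /forall_inP nok.
  have /fin_all_exists[k kP] j : exists k, j \in U -> (k \in Pa (Q s) j :\: Pa G j) /\ dout <= #|Ch G k|.
    have [jU|_] := boolP (j \in U); last by exists j.
    have /forallPn[i] := nok j jU; rewrite -ltnNge => gt.
    have sub k : S' j \subset k |: Pa G j -> i != k ->
        Ch (apply_node gn s j G) i \subset Ch G i.
      move=> /subsetP sub ik; apply/subsetP=> w; rewrite !inE /=.
      by case: eqP => // -> /sub; rewrite !inE (negPf ik).
    have [_ _ [s0|[k kD sk]]] := stepP j jU.
      have s1 : Ch (apply_node gn s j G) i \subset Ch G i.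
        apply/subsetP=> w; rewrite !inE /=.
        by case: eqP => // -> /(subsetP s0); rewrite inE.
      by have := leq_trans gt (subset_leq_card s1); rewrite ltnNge outG.
    exists k => _; split=> //; have [eik|ik] := eqVneq i k; last first.
      by have := leq_trans gt (subset_leq_card (sub k sk ik)); rewrite ltnNge outG.
    rewrite -ltnS -eik; apply: leq_trans gt _.
    apply: (@leq_trans #|j |: Ch G i|); last by rewrite cardsU1 -add1n leq_add2r leq_b1.
    apply/subset_leq_card/subsetP=> w; rewrite !inE /=.
    by case: eqP => [->|_ ->]; rewrite ?eqxx ?orbT.
  have [j jU le] := saturation_bound inG U0 (fun j jU => proj1 (kP j jU)).
  have [/setDP[_ kj] ge] := kP j jU.
  (* This settles the case where the minimum in [hout] is p: j is not yet a child of k j. *)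
  have ltp : #|Ch G (k j)| < p.
    rewrite -[X in _ < X]card_ord -cardsT; apply: proper_card.
    by rewrite properT; apply: contra kj => /eqP/setP/(_ j); rewrite !inE.
  have := leq_trans hout ge; rewrite geq_min; lia.
have [le1 lt sub] := stepP j jU.
have PaE i : Pa (apply_node gn s j G) i = if i == j then S' j else Pa G i.
  exact: Pa_set_parents.
have Gs' : apply_node gn s j G \in Gps s.
  apply/in_Gps => x y e; have : x \in Pa (apply_node gn s j G) y by rewrite inE.
  rewrite PaE; case: eqP => [->|_]; last by rewrite inE; apply: (in_Gps _ _ Gs).
  suff : S' j \subset preds s j by move=> /subsetP h /h; rewrite inE.
  case: sub => [s0|[k /setDP[kQ _] s0]]; first exact: subset_trans s0 (sPa j).
  by apply: subset_trans s0 _; rewrite subUset sub1set (subsetP (sPaQ j)) ?sPa.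
have lt' : edge_diff (apply_node gn s j G) (Q s) < edge_diff G (Q s).
  rewrite !edge_diffE (bigD1 j) //= [X in _ < X](bigD1 j) //= PaE eqxx.
  rewrite -addSn leq_add // leq_sum // => i /negPf ij; by rewrite PaE ij.
exists j; split=> //; first by move=> eq; move: lt'; rewrite eq ltnn.
rewrite inE Gs'; apply/GpP; split=> // [|i]; first exact: Gps_dag Gs'.
by rewrite PaE; case: ifP.
Qed.

Definition class_step (E E' : {set digraph p}) : Prop := exists j s G,
  [/\ G \in E :&: Gpsd s din dout, apply_node gn s j G <> G,
      apply_node gn s j G \in Gpsd s din dout & E' = eq_class (apply_node gn s j G)].

(** The first alternative allows an early stop, so n is only an upper bound on the number of
    moves. *)
Fixpoint reach n (E : {set digraph p}) : Prop :=
  E = eq_class Gstar \/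
  if n is n'.+1 then exists2 E', class_step E E' & reach n' E' else False.

Lemma reach_leq m n E : m <= n -> reach m E -> reach n E.
Proof.
elim: m n E => [|m IH] [|n] E //=; first by move=> _ [->|//]; left.
by move=> le [->|[E' st r]]; [left | right; exists E' => //; apply: IH r].
Qed.

Lemma reach_min_imap s G m : G \in Gpsd s din dout ->
  reach m (eq_class (Q s)) -> reach (edge_diff G (Q s) + m) (eq_class G).
Proof.
move=> + r; have [n] := ubnP (edge_diff G (Q s)); elim: n G => // n IH G lt Gs.
have [->|neq] := eqVneq G (Q s); first exact: reach_leq (leq_addl _ _) r.
have [j [ne Gs' lt']] := progress Gs neq.
apply: (@reach_leq (edge_diff (apply_node gn s j G) (Q s) + m).+1).
  by rewrite -addSn leq_add2r.
right; exists (eq_class (apply_node gn s j G)); last by apply: IH => //; lia.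
exists j, s, G; split=> //; rewrite in_setI Gs andbT; apply: mem_eq_class.
by move: Gs; rewrite !inE => /andP[/andP[]].
Qed.

(** Strong induction on the number of edges. [H1] has as many edges as [Q s]; going down to [Q t]
    takes at most |H1| - |Q t| moves, which leaves |Q t| for the rest. *)
Lemma min_imap_reach s : reach #|Q s| (eq_class (Q s)).
Proof.
have [n] := ubnP #|Q s|; elim: n s => // n IH s lt.
have dQ : is_dag (Q s) := Gps_dag (min_imap_Gps _ _).
case: (reducible_min_imap s dGstar) => [c|[H0 [H1 [d0 d1 pr im c]]]].
  apply: (@reach_leq 0) => //; left; apply/esym/eq_class_eq => //.
  exact: coveq_markov_equiv.
have [t H1t] := dag_Gps d1.
have H0t : H0 \in Gps t.
  by apply/in_Gps => x y /(subsetP (proper_sub pr)) e; apply: (in_Gps _ _ H1t).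
(* [H0] is an I-map of [Gstar] compatible with t, hence contains [Q t]; the edges added in [H1] make
   the inclusion strict. *)
have sub : Q t \subset H0 by rewrite -(min_imap_id H0t); apply: imap_min_imap.
have ltQ : #|Q t| < #|H1| := leq_ltn_trans (subset_leq_card sub) (proper_card pr).
have cardE : #|H1| = #|Q s| by rewrite (coveq_card c).
rewrite -(eq_class_eq d1 dQ (coveq_markov_equiv d1 dQ c)) -cardE.
rewrite -(subnK (ltnW ltQ)) -edge_diff_sub; last exact: subset_trans sub (proper_sub pr).
apply: reach_min_imap; last by apply: IH; lia.
(* Covered reversals preserve adjacency, so [H1] inherits the degree bound of [Q s] and the
   operators may start from it. *)
have nb j : #|Pa H1 j :|: Ch H1 j| <= d.
  apply: leq_trans (leq_dstar Gstar s j); rewrite !neighboursE subset_leq_card //.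
  by apply/subsetP=> i; rewrite !inE (coveq_adjacent _ _ c).
rewrite inE H1t; apply/GpP; split=> // j.
  by apply: leq_trans hin; apply: leq_trans (nb j); apply/subset_leq_card/subsetUl.
by apply: out_bound; apply: leq_trans (nb j); apply/subset_leq_card/subsetUr.
Qed.

Lemma class_reach E : E \in Cp p din dout -> reach ((d + din) * p) E.
Proof.
case/imsetP=> G Gp_ ->; have /GpP[dG inG outG] := Gp_; have [s Gs] := dag_Gps dG.
have GG : G \in Gpsd s din dout by rewrite inE Gs.
apply: reach_leq (reach_min_imap GG (min_imap_reach s)).
have := edge_diff_le G (Q s); have := handshake Gstar s.
have : #|G| <= din * p.
  by rewrite card_Pa mulnC -[X in X * _]card_ord -sum_nat_const; apply: leq_sum.
rewrite mulnDl; lia.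
Qed.

Lemma descent : exists g : {set digraph p} -> {set digraph p},
  g (eq_class Gstar) = eq_class Gstar /\
  forall E, E \in Cp p din dout -> E <> eq_class Gstar ->
    class_step E (g E) /\ forall n, reach n E -> reach n.-1 (g E).
Proof.
have /choice[g gP] E : exists E', E \in Cp p din dout -> E <> eq_class Gstar ->
    class_step E E' /\ forall n, reach n E -> reach n.-1 E'.
  have [EC|_] := boolP (E \in Cp p din dout); last by exists E.
  have [->|neq] := EM (E = eq_class Gstar); first by exists E.
  have ex : exists n, `[< reach n E >] by exists ((d + din) * p); apply/asboolP/class_reach.
  (* The first move of a shortest sequence is taken; every n with [reach n E] is at least its length
     m + 1, so the clause holds for all n at once. *)
  case: (ex_minnP ex) => -[|m] /asboolP rm minm; first by case: rm.
  case: rm => [//|[E' st r]].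
  exists E' => _ _; split=> // n rn; apply: reach_leq r.
  by have := minm n; rewrite asboolT // => /(_ isT); lia.
exists (fun E => if E == eq_class Gstar then eq_class Gstar else g E).
by rewrite eqxx; split=> // E EC neq; case: eqP => // _; apply: gP.
Qed.

End Progress.

Theorem theorem3 (R : realType) (p : nat) (Gstar : digraph p)
    (hGstar : is_dag Gstar)
    (psi : digraph p -> R) (psiloc : 'I_p -> {set 'I_p} -> R)
    (hdec : decomposable psi psiloc) (hequiv : score_equivalent psi)
    (din dout : nat) (hdin : 1 <= din <= p) (hdout : 1 <= dout <= p)
    (hin : dstar Gstar <= din)
    (hout : minn (dstar Gstar * din + 1) p <= dout)
    (gn : 'S_p -> 'I_p -> {set 'I_p} -> {set 'I_p})
    (hgn : ads_operator psiloc Gstar din gn) :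
  (forall s : 'S_p, min_imap Gstar s \in Gpsd s din dout) /\
  eq_class Gstar \in Cp p din dout /\
  exists g : {set digraph p} -> {set digraph p},
    [/\ (forall E, E \in Cp p din dout -> g E \in Cp p din dout),
        g (eq_class Gstar) = eq_class Gstar
      & forall E, E \in Cp p din dout -> E <> eq_class Gstar ->
          (exists (j : 'I_p) (s : 'S_p) (G : digraph p),
             [/\ G \in E :&: Gpsd s din dout,
                 apply_node gn s j G <> G
               & g E = eq_class (apply_node gn s j G)]) /\
          (exists k l : nat,
             [/\ k <= (dstar Gstar + din) * p,
                 k <= l <= (2 * dstar Gstar + din) * p,
                 (exists s : 'S_p, iter k g E = eq_class (min_imap Gstar s))
               & iter l g E = eq_class Gstar])].
Proof.
have din0 : 0 < din by case/andP: hdin.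
have minG s := min_imap_Gpsd din0 hin hout s.
(* For an ordering [s0] of [Gstar] the minimal I-map is [Gstar] itself. This places its class in
   [Cp], and later makes it the class of a minimal I-map. *)
have [s0 Gs0] := dag_Gps hGstar; have idG := min_imap_id Gs0.
have CG : eq_class Gstar \in Cp p din dout.
  by apply: imset_f; have := minG s0; rewrite idG inE => /andP[].
split=> //; split=> //.
have [g [g0 gP]] := descent hGstar din0 hin hout hgn.
have gC E : E \in Cp p din dout -> g E \in Cp p din dout.
  move=> EC; have [->|neq] := EM (E = eq_class Gstar); first by rewrite g0.
  have [[j [s [G [_ _ Gs ->]]]] _] := gP E EC neq.
  by apply: imset_f; move: Gs; rewrite inE => /andP[].
have iterg n E : E \in Cp p din dout -> reach Gstar din dout gn n E ->
    iter n g E = eq_class Gstar.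
  elim: n E => [|n IH] E EC r; first by case: r.
  rewrite iterSr; have [eqE|neq] := EM (E = eq_class Gstar).
    by rewrite eqE g0; elim: n {IH r} => //= n ->.
  by have [_ /(_ _ r)] := gP E EC neq; apply: IH; apply: gC.
exists g; split=> // E EC neq; split.
  by have [[j [s [G [GE ne _ ->]]]] _] := gP E EC neq; exists j, s, G.
have r := iterg _ _ EC (class_reach hGstar din0 hin hout hgn EC).
(* The choice k = l is possible because g fixes the class of [Gstar], which is also the class of the
   minimal I-map for [s0]. *)
exists ((dstar Gstar + din) * p), ((dstar Gstar + din) * p); split=> //.
  by rewrite leqnn leq_mul2r leq_add2r leq_pmull ?orbT.
by exists s0; rewrite idG.
Qed.
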